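(* Let $G=(V,E)$ be a connected locally finite graph, let $\Gamma$ be a closed subgroup of $\mathrm{Aut}(G)$ that acts transitively on $G$, and let $\mathbf{w}$ be the relative weight function induced by $\Gamma$. If $G$ is $\mathbf{w}$-nonamenable, then there exists a transitive graph $G'$ on the same vertex set $V$ that is quasi-isometric to $G$, such that $\Gamma$ acts transitively (by automorphisms) on $G'$, and such that $p_h(G',\Gamma)<p_u(G')$.
   Context: $\mathrm{Aut}(G)$ carries the topology of pointwise convergence. For $x\in V$, $\Gamma_x$ is the stabilizer of $x$ in $\Gamma$. The relative weight function is $\mathbf{w}^y(x):=|\Gamma_x y|/|\Gamma_y x|$ for $x,y\in V$ (it depends only on the action of $\Gamma$ on $V$). Fix a reference vertex $o\in V$ and write $\mathbf{w}(A)=\sum_{x\in A}\mathbf{w}^o(x)$ for $A\subseteq V$. A set $A\subseteq V$ is heavy if $\mathbf{w}(A)=\infty$ and light otherwise (independent of $o$). $G$ is $\mathbf{w}$-nonamenable if $\inf\{\mathbf{w}(\partial_V F)/\mathbf{w}(F): F\subseteq V,\ 0<|F|<\infty\}>0$, where $\partial_V F$ is the external vertex boundary of $F$. In Bernoulli$(p)$ bond percolation each edge is kept independently with probability $p$; clusters are the connected components of the resulting configuration, and $\mathbb{P}_p$ is its law. $p_h(G',\Gamma)=\sup\{p\in[0,1]:\mathbb{P}_p(\text{there is a heavy cluster})=0\}$ for percolation on $G'$, and $p_u(G')=\inf\{p\in[0,1]:\mathbb{P}_p(\text{there is exactly one infinite cluster})=1\}$. *)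

(* Defs.v *)
From mathcomp Require Import all_boot all_order all_algebra finmap.
From mathcomp Require Import all_classical all_reals all_analysis.

Set Implicit Arguments.
Unset Strict Implicit.
Unset Printing Implicit Defensive.
Import Order.TTheory GRing.Theory Num.Theory.
Local Open Scope classical_set_scope.
Local Open Scope ring_scope.

Record graph (V : Type) := Graph {
  adj : V -> V -> Prop;
  adj_sym : forall x y, adj x y -> adj y x;
  adj_irrefl : forall x, ~ adj x x }.

Definition walk (V : Type) (e : V -> V -> Prop) (x y : V) (n : nat) : Prop :=
  exists p : nat -> V,
    [/\ p 0%N = x, p n = y & forall i, (i < n)%N -> e (p i) (p i.+1)].

Definition component (V : Type) (e : V -> V -> Prop) (x : V) : set V :=
  [set y | exists n, walk e x y n].

Definition connected_graph (V : Type) (G : graph V) : Prop :=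
  forall x y, component (adj G) x y.

Definition locally_finite (V : Type) (G : graph V) : Prop :=
  forall x, finite_set (adj G x).

(* Only meaningful on connected graphs, since [inf set0 = 0]. *)
Definition graph_dist (R : realType) (V : Type) (G : graph V) (x y : V) : R :=
  inf [set n%:R | n in walk (adj G) x y].

Definition quasi_isometric (R : realType) (V W : Type)
    (G : graph V) (H : graph W) : Prop :=
  exists (f : V -> W) (A B : R),
    [/\ 1 <= A, 0 <= B,
        forall x y, A^-1 * graph_dist R G x y - B <= graph_dist R H (f x) (f y)
                    <= A * graph_dist R G x y + B
      & forall z, exists x, graph_dist R H (f x) z <= B].

Definition graph_Aut (V : choiceType) (G : graph V) :
    set {ptws V -> discrete_topology V} :=
  [set g | bijective g /\ forall x y, adj G (g x) (g y) <-> adj G x y].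

Record closed_subgroup_Aut (V : choiceType) (G : graph V)
    (Gamma : set (V -> V)) : Prop := {
  csg_sub : Gamma `<=` graph_Aut G;
  csg_id : Gamma id;
  csg_comp : forall g h, Gamma g -> Gamma h -> Gamma (g \o h);
  csg_inv : forall g h, Gamma g -> cancel g h -> cancel h g -> Gamma h;
  (* closed in [graph_Aut G] for the topology of pointwise convergence *)
  csg_closed : closed (Gamma : set (subspace (graph_Aut G))) }.

Definition acts_transitively (V : choiceType) (Gamma : set (V -> V))
    (G : graph V) : Prop :=
  Gamma `<=` graph_Aut G /\ forall x y, exists2 g, Gamma g & g x = y.

Definition stab_orbit (V : Type) (Gamma : set (V -> V)) (x y : V) : set V :=
  [set g y | g in [set g | Gamma g /\ g x = x]].

(* [fset_set] returns the empty set on infinite sets; here the orbits are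
   finite, as [Gamma] acts by automorphisms on a connected locally finite
   graph. *)
Definition rel_weight (R : realType) (V : choiceType) (Gamma : set (V -> V))
    (y x : V) : R :=
  #|` fset_set (stab_orbit Gamma x y)|%:R
    / #|` fset_set (stab_orbit Gamma y x)|%:R.

Definition weight (R : realType) (V : choiceType) (Gamma : set (V -> V))
    (o : V) (A : set V) : \bar R :=
  \esum_(x in A) (rel_weight R Gamma o x)%:E.

Definition heavy (R : realType) (V : choiceType) (Gamma : set (V -> V))
    (o : V) (A : set V) : Prop :=
  weight R Gamma o A = +oo%E.

Definition vertex_boundary (V : Type) (G : graph V) (F : set V) : set V :=
  [set y | ~ F y /\ exists2 x, F x & adj G x y].

Definition weight_nonamenable (R : realType) (V : choiceType) (G : graph V)
    (Gamma : set (V -> V)) (o : V) : Prop :=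
  (0 < ereal_inf [set weight R Gamma o (vertex_boundary G F)
                        / weight R Gamma o F
                 | F in [set F : set V | finite_set F /\ F !=set0]])%E.

Definition edge (V : Type) (G : graph V) : Type :=
  {e : set V | exists x y, adj G x y /\ e = [set x; y]}.

Definition config (V : Type) (G : graph V) : Type := edge G -> bool.

Definition cylinders (V : Type) (G : graph V) : set (set (config G)) :=
  [set C | exists (e : edge G) (b : bool), C = [set w | w e = b]].

(* [config G] with its product sigma-algebra *)
Definition config_space (V : Type) (G : graph V) :=
  g_sigma_algebraType (@cylinders V G).

(* [mu] is the product law of independent Bernoulli(p) variables, given by its
   values on finite-dimensional cylinders. *)
Definition bernoulli_law (R : realType) (V : Type) (G : graph V) (p : R)
    (mu : probability (config_space G) R) : Prop :=
  forall (n : nat) (e : 'I_n -> edge G) (b : 'I_n -> bool), injective e ->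
    mu [set w : config G | forall i, w (e i) = b i]
      = (\prod_(i < n) (if b i then p else 1 - p))%:E.

Definition open_adj (V : Type) (G : graph V) (w : config G) (x y : V) : Prop :=
  exists2 e : edge G, w e = true & sval e = [set x; y].

Definition is_cluster (V : Type) (G : graph V) (w : config G) (C : set V) : Prop :=
  exists x, C = component (open_adj w) x.

Definition has_heavy_cluster (R : realType) (V : choiceType) (G : graph V)
    (Gamma : set (V -> V)) (o : V) : set (config G) :=
  [set w | exists2 C, is_cluster w C & heavy R Gamma o C].

Definition unique_infinite_cluster (V : choiceType) (G : graph V) :
    set (config G) :=
  [set w | exists! C, is_cluster w C /\ infinite_set C].

(* The law [mu] below exists and is unique, by Kolmogorov's theorem. *)
Definition p_h (R : realType) (V : choiceType) (G : graph V)
    (Gamma : set (V -> V)) (o : V) : R :=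
  sup [set p : R | 0 <= p <= 1 /\
    exists2 mu : probability (config_space G) R,
      bernoulli_law p mu & mu (has_heavy_cluster R Gamma o) = 0%E].

Definition p_u (R : realType) (V : choiceType) (G : graph V) : R :=
  inf [set p : R | 0 <= p <= 1 /\
    exists2 mu : probability (config_space G) R,
      bernoulli_law p mu & mu (@unique_infinite_cluster V G) = 1%E].

(* Main.v *)
Require Import Defs.
From mathcomp Require Import all_boot all_order all_algebra finmap.
From mathcomp Require Import all_classical all_reals all_analysis.
From mathcomp Require Import lra zify.
Set Implicit Arguments.
Unset Strict Implicit.
Unset Printing Implicit Defensive.
Import Order.TTheory GRing.Theory Num.Theory.
Local Open Scope classical_set_scope.
Local Open Scope ring_scope.

(**
  Write [A] for the adjacency operator of [G], [w] for the weight seen from [o],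
  [r = sqrt w], and [d = sum_(y ~ o) r y], so that [A r = d r].  A weighted
  Cheeger inequality turns w-nonamenability into [||A|| <= B < d].

  By the mass-transport principle, the [d^-1 r]-tilted walk moves the weight
  like a symmetric random walk on a finitely generated abelian group; such a
  group grows polynomially, so after [2n] steps the tilted walk has its initial
  weight with probability at least [1 / poly(n)].  Sort the vertices [y] of
  weight [1] by the dyadic size of the number of [2n]-step walks from [o] to
  [y]: since there are only linearly many sizes, some level set [S] satisfies
  [||A_S|| <= poly(n) (B / d)^2n #|S|].  Let [G'] be [G] together with the edges
  of [S].

  All weights are equal along [S]-edges, so an infinite cluster of [S]-edges is
  heavy.  As [||A_S||] is far below the degree [#|S|], nearly all [S]-edges at a
  finite set leave it, and a Peierls argument bounds [p_h] by a constant times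
  [n / #|S|].  On the other hand [p ||A_G'|| < 1] makes the two-point function a
  bounded operator on l^2; a unique infinite cluster would give
  [theta^2 m^2 <= C m] for any [m] vertices, so [p_u >= 1 / ||A_G'||], which is
  exponentially larger in [n].
*)

(** * Walks and operator norms *)

(** The threshold for [B] is [d], not the degree: the conductances [r x * r y] add up to [d * w x]
    at [x], so w-expansion is ordinary expansion of this network.

    Dyadic levels are used because two opposite comparisons are needed on the same set. A lower
    bound [2 ^ i] on the counts puts [2 ^ i * A_S] entrywise below the [2n]-th power of [A], which
    bounds the norm of [A_S]; the upper bound [2 ^ i.+1] turns the mass of the level into a number
    of vertices.

    No l^2 space appears. Norms are bounds on quadratic forms over finite lists, and powers are
    computed on lists large enough to contain every walk involved.

    The inequality finally proved is [p_h <= 1 / c < 1 / (beta + B) <= p_u], where [beta + B] bounds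
    the norm of [A_G'] and [c] is an integer just above it. The exponential slack is spent on
    [c * a + beta <= M], with [M] the degree of the [S]-edges and [a] linear in [n]; this makes the
    Peierls sum converge already at [p = 1 / c]. *)

Section Walks.
Variables (V : Type) (e : V -> V -> Prop).

Lemma walk0 x y : walk e x y 0 <-> x = y.
Proof.
split=> [[p [<- <- _]]//|->].
by exists (fun=> y); split.
Qed.

Lemma walkS x y n : walk e x y n.+1 <-> exists2 z, e x z & walk e z y n.
Proof.
split=> [[p [<- <- ep]]|[z exz [p [p0 pn ep]]]].
  exists (p 1%N); first exact: ep.
  by exists (fun i => p i.+1); split=> // i ?; apply: ep.
exists (fun i => if i is j.+1 then p j else x); split=> // -[_|i ?] //=.
  by rewrite p0.
exact: ep.
Qed.

Lemma walk_cat x y z m n : walk e x y m -> walk e y z n -> walk e x z (m + n)%N.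
Proof.
elim: m x => [|m IH] x; first by move=> /walk0 ->.
move=> /walkS[u xu uy] yz; rewrite addSn; apply/walkS; exists u => //.
exact: IH.
Qed.

Lemma walk1 x y : walk e x y 1 <-> e x y.
Proof.
split; first by move=> /walkS[z xz /walk0 <-].
by move=> xy; apply/walkS; exists y => //; apply/walk0.
Qed.

Lemma walkSr x y n : walk e x y n.+1 <-> exists2 z, walk e x z n & e z y.
Proof.
split=> [|[z xz /walk1 zy]]; last by rewrite -addn1; exact: walk_cat zy.
elim: n x => [|n IH] x.
  by move=> /walk1 xy; exists x => //; apply/walk0.
move=> /walkS[u xu /IH[z uz zy]]; exists z => //.
by apply/walkS; exists u.
Qed.

Lemma walk_sym x y n : (forall x y, e x y -> e y x) ->
  walk e x y n -> walk e y x n.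
Proof.
move=> es; elim: n y => [|n IH] y; first by move=> /walk0 ->; apply/walk0.
by move=> /walkSr[z xz zy]; apply/walkS; exists z; [exact: es|exact: IH].
Qed.

Lemma walk_map (h : V -> V) x y n : (forall x y, e x y -> e (h x) (h y)) ->
  walk e x y n -> walk e (h x) (h y) n.
Proof.
by move=> eh [p [<- <- ep]]; exists (h \o p); split=> // i /ep /eh.
Qed.

Lemma finite_walk x n : (forall x, finite_set (e x)) ->
  finite_set [set y | walk e x y n].
Proof.
move=> fe; elim: n x => [|n IH] x.
  by apply: (sub_finite_set _ (finite_set1 x)) => y /= /walk0 ->.
apply: (@sub_finite_set _ _ (\bigcup_(z in e x) [set y | walk e z y n])).
  by move=> y /= /walkS[z xz zy]; exists z.
exact: bigcup_finite.
Qed.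

End Walks.

Lemma walk_sub (V : Type) (e e' : V -> V -> Prop) x y n :
  (forall x y, e x y -> e' x y) -> walk e x y n -> walk e' x y n.
Proof.
by move=> ee' [p [<- <- ep]]; exists p; split=> // i /ep /ee'.
Qed.

Section Kernel.
Variables (R : realType) (V : choiceType) (e : V -> V -> Prop).
Hypothesis e_fin : forall x, finite_set (e x).

Definition nsum (f : V -> R) (x : V) : R := \sum_(y <- fset_set (e x)) f y.

(** Entry [(x, y)] of the [n]-th power of the operator [nsum], kept as a natural number so that it
    can be sorted by powers of two. *)
Fixpoint cnt (n : nat) (x y : V) : nat :=
  if n is m.+1 then (\sum_(z <- fset_set (e x)) cnt m z y)%N else (x == y).

Lemma mem_nb x y : (y \in fset_set (e x)) = `[< e x y >].
Proof. by rewrite in_fset_set// in_setE. Qed.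

Lemma eq_nsum f g x : (forall y, e x y -> f y = g y) -> nsum f x = nsum g x.
Proof.
by move=> fg; rewrite /nsum; apply: eq_big_seq => y; rewrite mem_nb => /asboolP/fg.
Qed.

Lemma nsum_filter (s : seq V) f x : uniq s -> (forall y, e x y -> y \in s) ->
  nsum f x = \sum_(y <- s | `[< e x y >]) f y.
Proof.
move=> us xs; rewrite /nsum -[RHS]big_filter; apply: perm_big.
apply: uniq_perm; [exact: fset_uniq|exact: filter_uniq|move=> y].
by rewrite mem_nb mem_filter; case: asboolP => //= /xs ->.
Qed.

Lemma cntE n x y : (cnt n x y)%:R = iter n nsum (fun z => (z == y)%:R) x.
Proof.
elim: n x => [//|n IH] x /=; rewrite natr_sum.
by apply: eq_nsum => z _; rewrite IH.
Qed.

Lemma iter_nsum_le n f g x : (forall y, walk e x y n -> f y <= g y) ->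
  iter n nsum f x <= iter n nsum g x.
Proof.
elim: n x => [|n IH] x fg /=; first by apply: fg; apply/walk0.
rewrite /nsum big_seq [leRHS]big_seq; apply: ler_sum => y.
rewrite mem_nb => /asboolP xy; apply: IH => z yz; apply: fg.
by apply/walkS; exists y.
Qed.

Lemma eq_iter_nsum n f g x : (forall y, walk e x y n -> f y = g y) ->
  iter n nsum f x = iter n nsum g x.
Proof.
by move=> fg; apply/eqP; rewrite eq_le !iter_nsum_le// => y /fg ->.
Qed.

Lemma iter_nsum_sum (I : Type) (l : seq I) (c : I -> R) (F : I -> V -> R) n x :
  iter n nsum (fun z => \sum_(i <- l) c i * F i z) x =
  \sum_(i <- l) c i * iter n nsum (F i) x.
Proof.
elim: n x => [//|n IH] x /=.
rewrite (@eq_nsum _ (fun z => \sum_(i <- l) c i * iter n nsum (F i) z))//.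
rewrite /nsum exchange_big; apply: eq_bigr => i _.
by rewrite mulr_sumr.
Qed.

Lemma iter_nsumZ c F n x :
  iter n nsum (fun z => c * F z) x = c * iter n nsum F x.
Proof.
have := iter_nsum_sum [:: tt] (fun=> c) (fun=> F) n x.
rewrite big_seq1 => <-; apply: eq_iter_nsum => y _.
by rewrite big_seq1.
Qed.

Lemma sum_delta (l : seq V) (f : V -> R) x : uniq l ->
  \sum_(y <- l) f y * (x == y)%:R = f x * (x \in l)%:R.
Proof.
move=> ul; case: (boolP (x \in l)) => xl; last first.
  rewrite mulr0 big_seq big1// => y yl; case: eqP => [xy|]; last by rewrite mulr0.
  by rewrite -xy (negbTE xl) in yl.
rewrite (bigD1_seq x)//= eqxx big1 ?addr0// => y yx.
by rewrite eq_sym (negbTE yx) mulr0.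
Qed.

(** Only vertices reachable in [n] steps matter, so [f] may have infinite support outside [l]. *)
Lemma iter_nsum_cnt (l : seq V) f n x : uniq l ->
  (forall y, walk e x y n -> y \notin l -> f y = 0) ->
  iter n nsum f x = \sum_(y <- l) f y * (cnt n x y)%:R.
Proof.
move=> ul f0; under [RHS]eq_bigr do rewrite cntE.
rewrite -iter_nsum_sum; apply: eq_iter_nsum => y xy.
rewrite sum_delta//; have [|/f0->//] := boolP (y \in l); first by rewrite mulr1.
by rewrite mul0r.
Qed.

Lemma walk_cnt n x y : walk e x y n -> (0 < cnt n x y)%N.
Proof.
elim: n x => [|n IH] x /=; first by move=> /walk0 ->; rewrite eqxx.
move=> /walkS[z xz zy]; rewrite lt0n sum_nat_seq_neq0; apply/hasP.
by exists z; rewrite ?mem_nb/=; [apply/asboolP|rewrite -lt0n IH].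
Qed.

Hypothesis e_sym : forall x y, e x y -> e y x.

Lemma cntSr n x y : cnt n.+1 x y = (\sum_(z <- fset_set (e y)) cnt n x z)%N.
Proof.
elim: n x => [|n IH] x.
  have nE u v : (\sum_(z <- fset_set (e u)) (z == v) = `[< e u v >])%N.
    rewrite -mem_nb -(count_uniq_mem v (fset_uniq _)) -sum1_count [RHS]big_mkcond.
    by apply: eq_bigr => z _ /=; case: eqP.
  rewrite /= nE; under eq_bigr do rewrite eq_sym; rewrite nE.
  by congr nat_of_bool; apply/asboolP/asboolP; exact: e_sym.
rewrite [LHS]/=; under eq_bigr do rewrite -/(cnt n.+1 _ _) IH.
by rewrite exchange_big.
Qed.

Lemma cnt_sym n x y : cnt n x y = cnt n y x.
Proof.
elim: n x y => [|n IH] x y; first by rewrite /= eq_sym.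
by rewrite cntSr /=; apply: eq_bigr => z _; rewrite IH.
Qed.

End Kernel.

(** * Norm bounds from the quadratic form *)

Section FormBound.
Variables (R : realType) (V : choiceType) (e : V -> V -> Prop).

(** Says that the adjacency operator has l^2-norm at most [B]. Nonnegative [f] suffice because the
    kernel is nonnegative, as [form_bound_abs] shows. *)
Definition form_bound (B : R) := forall (s : seq V) (f : V -> R), uniq s ->
  (forall x, 0 <= f x) ->
  \sum_(x <- s) \sum_(y <- s | `[< e x y >]) f x * f y
    <= B * \sum_(x <- s) f x ^+ 2.

(** The compression of the adjacency operator to [s]. *)
Definition rsum (s : seq V) (f : V -> R) (x : V) : R :=
  \sum_(y <- s | `[< e x y >]) f y.

Lemma form_bound_abs B s f : form_bound B -> uniq s ->
  `|\sum_(x <- s) f x * rsum s f x| <= B * \sum_(x <- s) f x ^+ 2.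
Proof.
move=> fB us; have -> : \sum_(x <- s) f x ^+ 2 = \sum_(x <- s) `|f x| ^+ 2.
  by apply: eq_bigr => x _; rewrite -normrX ger0_norm// sqr_ge0.
apply: le_trans (fB s (fun x => `|f x|) us _) => //.
apply: le_trans (ler_norm_sum _ _ _) _; apply: ler_sum => x _.
rewrite /rsum mulr_sumr; apply: le_trans (ler_norm_sum _ _ _) _.
by apply: ler_sum => y _; rewrite normrM.
Qed.

Hypothesis e_sym : forall x y, e x y -> e y x.

Lemma rsum_adj s f g :
  \sum_(x <- s) f x * rsum s g x = \sum_(x <- s) g x * rsum s f x.
Proof.
rewrite /rsum.
under eq_bigr do rewrite mulr_sumr big_mkcond.
under [RHS]eq_bigr do rewrite mulr_sumr big_mkcond.
rewrite exchange_big; apply: eq_bigr => y _; apply: eq_bigr => x _.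
suff -> : `[< e x y >] = `[< e y x >] by rewrite mulrC.
by apply/asboolP/asboolP; exact: e_sym.
Qed.

Lemma rsumDZ s f g c x :
  rsum s (fun z => f z + c * g z) x = rsum s f x + c * rsum s g x.
Proof. by rewrite /rsum big_split/= mulr_sumr. Qed.

(** For a symmetric operator the form controls the norm. Compare the form at [u + B g] and at
    [u - B g], where [u] is the image of [g]: the cross term and the two diagonal values cancel,
    leaving [4 B |u|^2 <= 2 B |u|^2 + 2 B^3 |g|^2]. *)
Lemma rsum_norm (B : R) s g : 0 < B -> form_bound B -> uniq s ->
  \sum_(x <- s) rsum s g x ^+ 2 <= B ^+ 2 * \sum_(x <- s) g x ^+ 2.
Proof.
move=> B0 fB us; set u := rsum s g.
have h c : \sum_(x <- s) (u x + c * g x) * rsum s (fun z => u z + c * g z) x =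
    \sum_(x <- s) u x * rsum s u x + 2 * c * (\sum_(x <- s) u x ^+ 2)
    + c ^+ 2 * (\sum_(x <- s) g x * rsum s g x).
  under eq_bigr do rewrite rsumDZ.
  transitivity (\sum_(x <- s) (u x * rsum s u x + c * (u x * rsum s g x)
     + c * (g x * rsum s u x) + c ^+ 2 * (g x * rsum s g x))).
    by apply: eq_bigr => x _; nra.
  have E1 : \sum_(x <- s) u x * rsum s g x = \sum_(x <- s) u x ^+ 2.
    by apply: eq_bigr => x _; rewrite expr2.
  have E2 : \sum_(x <- s) g x * rsum s u x = \sum_(x <- s) u x ^+ 2.
    by rewrite rsum_adj.
  rewrite !big_split/= -!mulr_sumr E1 E2; lra.
have n c : \sum_(x <- s) (u x + c * g x) ^+ 2 = \sum_(x <- s) u x ^+ 2 +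
    2 * c * (\sum_(x <- s) u x * g x) + c ^+ 2 * \sum_(x <- s) g x ^+ 2.
  rewrite !mulr_sumr -!big_split/=; apply: eq_bigr => x _; nra.
have := form_bound_abs (fun z => u z + B * g z) fB us.
have := form_bound_abs (fun z => u z + (- B) * g z) fB us.
rewrite !h !n !ler_norml => /andP[+ _] /andP[_ +].
move: (\sum_(x <- s) u x ^+ 2) (\sum_(x <- s) g x ^+ 2) (\sum_(x <- s) u x * g x)
  (\sum_(x <- s) u x * rsum s u x) (\sum_(x <- s) g x * rsum s g x) => U G X Y Z h1 h2.
rewrite -(ler_pM2l B0); nra.
Qed.

Lemma iter_rsum_norm (B : R) s g n : 0 < B -> form_bound B -> uniq s ->
  \sum_(x <- s) iter n (rsum s) g x ^+ 2 <= B ^+ n ^+ 2 * \sum_(x <- s) g x ^+ 2.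
Proof.
move=> B0 fB us; elim: n => [|n IH]; first by rewrite expr0 expr1n mul1r.
rewrite iterS (le_trans (rsum_norm _ B0 fB us))//.
rewrite [B ^+ n.+1]exprS exprMn -[leRHS]mulrA; apply: ler_wpM2l => //; exact: sqr_ge0.
Qed.

Lemma iter_rsum_form (B : R) s g n : 0 < B -> form_bound B -> uniq s ->
  \sum_(x <- s) g x * iter n (rsum s) g x <= B ^+ n * \sum_(x <- s) g x ^+ 2.
Proof.
move=> B0 fB us; have := iter_rsum_norm g n B0 fB us.
have : 0 < B ^+ n by rewrite exprn_gt0.
move: (B ^+ n) => C C0 h.
have : \sum_(x <- s) 2 * C * (g x * iter n (rsum s) g x) <=
    \sum_(x <- s) (C ^+ 2 * g x ^+ 2 + iter n (rsum s) g x ^+ 2).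
  apply: ler_sum => x _.
  have := sqr_ge0 (C * g x - iter n (rsum s) g x); nra.
rewrite big_split/= -!mulr_sumr; move: h.
set X := \sum_(x <- s) g x ^+ 2; set Y := \sum_(x <- s) _ ^+ 2.
set Z := \sum_(x <- s) _ => h1 h2.
rewrite -(ler_pM2l C0); nra.
Qed.

Hypothesis e_fin : forall x, finite_set (e x).

Lemma iter_nsum_rsum s g n x :
  (forall k y, (k <= n)%N -> walk e x y k -> y \in s) -> uniq s ->
  iter n (nsum e) g x = iter n (rsum s) g x.
Proof.
move=> + us; elim: n x => [//|n IH] x xs /=.
transitivity (\sum_(y <- fset_set (e x)) iter n (rsum s) g y).
  apply: eq_nsum => // y xy; apply: IH => k z kn yz; apply: (xs k.+1) => //.
  by apply/walkS; exists y.
by apply: nsum_filter => // y xy; apply: (xs 1%N) => //; apply/walk1.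
Qed.

(** A power of a compression is not the compression of the power. Enlarging [s] to all vertices
    within [n] steps makes the two agree on functions supported in [s]. *)
Lemma pow_form (B : R) s (f : V -> R) n : 0 < B -> form_bound B -> uniq s ->
  (forall x, 0 <= f x) ->
  \sum_(x <- s) \sum_(y <- s) f x * f y * (cnt e n x y)%:R
    <= B ^+ n * \sum_(x <- s) f x ^+ 2.
Proof.
move=> B0 fB us f0.
pose U := \bigcup_(x in [set` s])
    \bigcup_(k in [set k | (k < n.+1)%N]) [set y | walk e x y k].
have Sfin : finite_set U.
  apply: bigcup_finite => // x _; apply: bigcup_finite => [|k _].
    exact: finite_II.
  exact: finite_walk.
pose s' : seq V := fset_set U.
have ss' x y k : x \in s -> (k <= n)%N -> walk e x y k -> y \in s'.
  move=> xs kn xy; rewrite /s' in_fset_set// in_setE; exists x => //.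
  by exists k.
have us' : uniq s' by exact: fset_uniq.
pose g x := f x * (x \in s)%:R.
have gs (F : V -> R) : \sum_(x <- s) f x * F x = \sum_(x <- s') g x * F x.
  rewrite [RHS](eq_bigr (fun x => if x \in s then f x * F x else 0)); last first.
    by move=> x _; rewrite /g; case: ifP; rewrite ?mulr1 ?mulr0 ?mul0r.
  rewrite -big_mkcond -big_filter; apply: perm_big; apply: uniq_perm => //.
    exact: filter_uniq.
  move=> x; rewrite mem_filter; case: (boolP (x \in s)) => //= xs.
  by rewrite (ss' x x 0%N)//; apply/walk0.
have -> : \sum_(x <- s) f x ^+ 2 = \sum_(x <- s') g x ^+ 2.
  under eq_bigr do rewrite expr2; rewrite gs; apply: eq_bigr => x _.
  by rewrite /g; case: (x \in s); rewrite ?mulr1 ?mulr0 ?mul0r ?expr0n ?expr2.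
have gE x : \sum_(y <- s) f y * (cnt e n x y)%:R = iter n (nsum e) g x.
  rewrite (iter_nsum_cnt _ us)//; last by rewrite /g => y _ /negbTE ->; rewrite mulr0.
  by apply: eq_big_seq => y ys; rewrite /g ys mulr1.
have -> : \sum_(x <- s) \sum_(y <- s) f x * f y * (cnt e n x y)%:R =
    \sum_(x <- s') g x * iter n (rsum s') g x.
  rewrite -gs; apply: eq_big_seq => x xs.
  rewrite -(@iter_nsum_rsum s' g n x)//; last by move=> k y; exact: ss'.
  by rewrite -gE mulr_sumr; apply: eq_bigr => y _; rewrite mulrA.
exact: iter_rsum_form.
Qed.

(** On the indicator of two distinct vertices the form of the [n]-th power is
    [cnt x x + 2 cnt x y + cnt y y], which is at most [2 B^n]. *)
Lemma cnt_le (B : R) n x y : 0 < B -> form_bound B -> (cnt e n x y)%:R <= B ^+ n.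
Proof.
move=> B0 fB; have [->|xy] := eqVneq x y.
  have := @pow_form B [:: y] (fun=> 1) n B0 fB isT.
  by rewrite !big_seq1 !mul1r expr1n mulr1; apply.
have := @pow_form B [:: x; y] (fun=> 1) n B0 fB.
rewrite /= inE xy !big_cons !big_nil !mul1r !expr1n !addr0 => /(_ isT (fun=> ler01)).
rewrite (cnt_sym e_fin e_sym n y x).
have : 0 <= (cnt e n x x)%:R :> R by [].
have : 0 <= (cnt e n y y)%:R :> R by [].
lra.
Qed.

End FormBound.

(** * Relative weights and mass transport *)

Section FiniteCounting.

Lemma sum_ind (T : choiceType) (A P : set T) : finite_set A ->
  (\sum_(z <- fset_set A) `[< P z >])%N = #|` fset_set (A `&` P)|.
Proof.
move=> fA; have fAP : finite_set (A `&` P) by exact: finite_setIl.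
transitivity (count (fun z => `[< P z >]) (fset_set A)).
  by rewrite -sum1_count [RHS]big_mkcond; apply: eq_bigr => z _; case: `[< _ >].
rewrite -size_filter; apply: perm_size; apply: uniq_perm.
- by apply: filter_uniq; exact: fset_uniq.
- exact: fset_uniq.
move=> z; rewrite mem_filter !in_fset_set// in_setI andbC.
by congr andb; rewrite -[RHS]asboolb; apply/asboolP/asboolP; rewrite in_setE.
Qed.

Lemma card_image (T U : choiceType) (h : T -> U) (A : set T) :
  injective h -> finite_set A -> #|` fset_set (h @` A)| = #|` fset_set A|.
Proof. by move=> hI fA; rewrite fset_set_image// card_imfset. Qed.

Lemma double_count (T U : choiceType) (Y : set T) (Z : set U)
    (r : T -> U -> Prop) (a b : nat) : finite_set Y -> finite_set Z ->
  (forall y, Y y -> #|` fset_set (Z `&` r y)| = a) ->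
  (forall z, Z z -> #|` fset_set (Y `&` r^~ z)| = b) ->
  (#|` fset_set Y| * a = #|` fset_set Z| * b)%N.
Proof.
move=> fY fZ ra rb.
have cst (S : choiceType) (X : set S) (F : S -> nat) c : finite_set X ->
    (forall x, X x -> F x = c) -> (\sum_(x <- fset_set X) F x = #|` fset_set X| * c)%N.
  move=> fX Fc; rewrite (eq_big_seq (fun=> c)).
    by rewrite big_const_seq count_predT iter_addn_0 mulnC.
  by move=> x; rewrite in_fset_set// in_setE => /Fc.
rewrite -(cst _ _ (fun y => \sum_(z <- fset_set Z) `[< r y z >])%N)//; last first.
  by move=> y Yy; rewrite sum_ind// ra.
rewrite -(cst _ _ (fun z => \sum_(y <- fset_set Y) `[< r y z >])%N)//; last first.
  by move=> z Zz; rewrite (@sum_ind _ _ (r^~ z))// rb.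
by rewrite exchange_big.
Qed.

End FiniteCounting.

Section Weights.
Variables (R : realType) (V : choiceType) (Gamma : set (V -> V)).
Hypothesis Gamma_id : Gamma id.
Hypothesis Gamma_comp : forall g h, Gamma g -> Gamma h -> Gamma (g \o h).
Hypothesis Gamma_inv : forall g, Gamma g ->
  exists h, [/\ Gamma h, cancel g h & cancel h g].
Hypothesis Gamma_tr : forall x y, exists2 g, Gamma g & g x = y.
Hypothesis orbit_fin : forall x y, finite_set (stab_orbit Gamma x y).

Local Notation m x y := #|` fset_set (stab_orbit Gamma x y)|.

Lemma Gamma_inj g : Gamma g -> injective g.
Proof. by move=> /Gamma_inv[h [_ gh _]]; exact: can_inj gh. Qed.

Lemma stab_orbit_map g x y : Gamma g ->
  stab_orbit Gamma (g x) (g y) = g @` stab_orbit Gamma x y.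
Proof.
move=> Gg; have [h [Gh gh hg]] := Gamma_inv Gg.
apply/seteqP; split=> z.
  move=> [k [Gk kx] <-]; exists (h (k (g y))); last by rewrite hg.
  exists (h \o (k \o g)) => //; split; last by rewrite /= kx gh.
  by apply: (Gamma_comp Gh); exact: Gamma_comp.
move=> [_ [k [Gk kx] <-] <-]; exists (g \o (k \o h)); last by rewrite /= gh.
split; last by rewrite /= gh kx.
by apply: (Gamma_comp Gg); exact: Gamma_comp.
Qed.

Lemma card_orbit_map g x y : Gamma g -> m (g x) (g y) = m x y.
Proof.
by move=> Gg; rewrite stab_orbit_map// card_image//; exact: Gamma_inj.
Qed.

Lemma card_orbit_gt0 x y : (0 < m x y)%N.
Proof.
rewrite cardfs_gt0; apply/fset0Pn; exists y.
by rewrite in_fset_set// in_setE; exists id.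
Qed.

Let stab2 x y z := [set g z | g in [set g | [/\ Gamma g, g x = x & g y = y]]].

Let stab2_fin x y z : finite_set (stab2 x y z).
Proof.
by apply: sub_finite_set (orbit_fin x z) => _ [g [Gg gx gy] <-]; exists g.
Qed.

Let stab2C x y z : stab2 x y z = stab2 y x z.
Proof. by apply/seteqP; split=> _ [g [Gg gx gy] <-]; exists g. Qed.

(** Both sides count the orbit of the pair [(y, z)] under the stabilizer of [x], fibred over one
    coordinate or the other. This does the work of the tower law for subgroup indices. *)
Let card_orbit_pair x y z :
  (m x y * #|` fset_set (stab2 x y z)| = m x z * #|` fset_set (stab2 x z y)|)%N.
Proof.
apply: (@double_count _ _ _ _
  (fun y' z' => exists g, [/\ Gamma g, g x = x, g y = y' & g z = z'])) => //.
  move=> _ [h [Gh hx] <-]; have [k [Gk hk kh]] := Gamma_inv Gh.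
  rewrite -[RHS](card_image (Gamma_inj Gh))//; congr (#|` fset_set _|).
  apply/seteqP; split=> z' /=.
    move=> [_ [g [Gg gx gy <-]]]; exists (k (g z)); last by rewrite kh.
    exists (k \o g) => //; split; first exact: Gamma_comp.
      by rewrite /= gx -{1}hx hk.
    by rewrite /= gy hk.
  move=> [_ [g [Gg gx gy] <-] <-]; split.
    exists (h \o g) => //; split; first exact: Gamma_comp.
    by rewrite /= gx.
  exists (h \o g); split=> //; first exact: Gamma_comp.
    by rewrite /= gx.
  by rewrite /= gy.
move=> _ [h [Gh hx] <-]; have [k [Gk hk kh]] := Gamma_inv Gh.
rewrite -[RHS](card_image (Gamma_inj Gh))//; congr (#|` fset_set _|).
apply/seteqP; split=> z' /=.
  move=> [_ [g [Gg gx <- gz]]]; exists (k (g y)); last by rewrite kh.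
  exists (k \o g) => //; split; first exact: Gamma_comp.
    by rewrite /= gx -{1}hx hk.
  by rewrite /= gz hk.
move=> [_ [g [Gg gx gy] <-] <-]; split.
  exists (h \o g) => //; split; first exact: Gamma_comp.
  by rewrite /= gx.
exists (h \o g); split=> //; first exact: Gamma_comp.
  by rewrite /= gx.
by rewrite /= gy.
Qed.

Local Notation W := (rel_weight R Gamma).

Lemma weight_gt0 x y : 0 < W x y.
Proof. by rewrite divr_gt0// ltr0n card_orbit_gt0. Qed.

Lemma weight_map g x y : Gamma g -> W (g x) (g y) = W x y.
Proof. by move=> Gg; rewrite /rel_weight !card_orbit_map. Qed.

(** Multiply the instances of [card_orbit_pair] based at the three vertices: the orbits of the joint
    stabilizers cancel. *)
Lemma weight_cocycle x y z : W x z = W x y * W y z.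
Proof.
have s2gt0 u v w : (0 < #|` fset_set (stab2 u v w)|)%N.
  rewrite cardfs_gt0; apply/fset0Pn; exists w.
  by rewrite in_fset_set// in_setE; exists id.
have := card_orbit_pair x y z; have := card_orbit_pair y x z.
have := card_orbit_pair z x y.
rewrite (stab2C y x z) (stab2C z x y) (stab2C z y x) /rel_weight.
have := s2gt0 x y z; have := s2gt0 x z y; have := s2gt0 y z x.
have := card_orbit_gt0 x y; have := card_orbit_gt0 y x.
have := card_orbit_gt0 x z; have := card_orbit_gt0 z x.
have := card_orbit_gt0 z y; have := card_orbit_gt0 y z.
move: (m x y) (m y x) (m x z) (m z x) (m y z) (m z y)
  (#|` fset_set (stab2 x y z)|) (#|` fset_set (stab2 x z y)|)
  (#|` fset_set (stab2 y z x)|).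
move=> a a' b b' c c' p q r a0 a'0 b0 b'0 c0 c'0 p0 q0 r0 h1 h2 h3.
rewrite mulf_div; apply/eqP; rewrite eqr_div ?pnatr_eq0 -?lt0n ?muln_gt0 ?a0//;
  last by rewrite -natrM pnatr_eq0 -lt0n muln_gt0; apply/andP.
rewrite -!natrM eqr_nat.
have pqr0 : (0 < p * q * r)%N by rewrite !muln_gt0; apply/andP; split=> //; apply/andP.
rewrite -(eqn_pmul2r pqr0).
apply/eqP; transitivity ((b' * q) * (a * p) * (c * r))%N; first by nia.
rewrite h1 h3 -h2; nia.
Qed.

Lemma weight_id x : W x x = 1.
Proof.
by have := weight_cocycle x x x; have := weight_gt0 x x; nra.
Qed.

Lemma weight_sym x y : W y x = (W x y)^-1.
Proof.
have := weight_cocycle x y x; rewrite weight_id => h.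
have W0 := weight_gt0 x y.
by apply: (mulfI (lt0r_neq0 W0)); rewrite -h divff// lt0r_neq0.
Qed.

(** Double counting of the pairs [(y, z)] for which a single group element takes [x] to [z] and [y]
    to [x]. A given [y] has [m y x] partners and a given [z] has [m z x]. Invariance gives
    [m y x = m x z] on such pairs, and the ratio of the two numbers is the weight. *)
Lemma mass_transport (E : V -> V -> Prop) (phi : V -> V -> R) x :
  (forall g u v, Gamma g -> E u v -> E (g u) (g v)) ->
  (forall g u v, Gamma g -> phi (g u) (g v) = phi u v) ->
  finite_set (E x) -> finite_set (E^~ x) ->
  \sum_(y <- fset_set (E x)) phi x y =
  \sum_(z <- fset_set (E^~ x)) phi z x * W x z.
Proof.
move=> EG phiG fY fZ.
pose r y z := exists g, [/\ Gamma g, g x = z & g y = x].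
have ry y : E x y -> #|` fset_set (E^~ x `&` r y)| = m y x.
  move=> xy; have [g0 Gg0 g0y] := Gamma_tr y x.
  have [k [Gk gk kg]] := Gamma_inv Gg0.
  rewrite -[RHS](card_orbit_map _ _ Gg0) g0y; congr (#|` fset_set _|).
  apply/seteqP; split=> z.
    move=> [_ [g [Gg <- gy]]]; exists (g \o k); last by rewrite /= gk.
    by split; [exact: Gamma_comp|rewrite /= -{1}g0y gk gy].
  move=> [g [Gg gx] <-]; have Ggg : Gamma (g \o g0) by exact: Gamma_comp.
  split; last by exists (g \o g0); split=> //=; rewrite g0y.
  by have := EG _ _ _ Ggg xy; rewrite /= g0y gx.
have rz z : E z x -> #|` fset_set (E x `&` r^~ z)| = m z x.
  move=> zx; have [g0 Gg0 g0x] := Gamma_tr x z.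
  have [k [Gk gk kg]] := Gamma_inv Gg0.
  rewrite -[RHS](card_orbit_map _ _ Gk) -[in RHS]g0x gk; congr (#|` fset_set _|).
  apply/seteqP; split=> y.
    move=> [_ [g [Gg gx gy]]]; have [h [Gh gh hg]] := Gamma_inv Gg.
    exists (h \o g0); last by rewrite /= kg -gy gh.
    by split; [exact: Gamma_comp|rewrite /= g0x -gx gh].
  move=> [g [Gg gx] <-]; have [h [Gh gh hg]] := Gamma_inv Gg.
  have Ggg : Gamma (g \o k) by exact: Gamma_comp.
  split; first by have := EG _ _ _ Ggg zx; rewrite /= -{1}g0x gk gx.
  exists (g0 \o h); split; first exact: Gamma_comp.
    by rewrite /= -{1}gx gh.
  by rewrite /= gh kg.
transitivity (\sum_(y <- fset_set (E x)) \sum_(z <- fset_set (E^~ x))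
    phi x y / (m y x)%:R * (`[< r y z >] : nat)%:R).
  apply: eq_big_seq => y; rewrite in_fset_set// in_setE => xy.
  rewrite -mulr_sumr -natr_sum sum_ind// ry// divfK//.
  by rewrite pnatr_eq0 -lt0n card_orbit_gt0.
rewrite exchange_big; apply: eq_big_seq => z; rewrite in_fset_set// in_setE => zx.
rewrite (eq_bigr (fun y => phi z x / (m x z)%:R * (`[< r y z >] : nat)%:R)).
  rewrite -mulr_sumr -natr_sum (@sum_ind _ _ (r^~ z))// rz// /rel_weight.
  by rewrite mulrAC mulrA.
move=> y _; case: asboolP => [[g [Gg gx gy]]|_]; last by rewrite !mulr0.
by rewrite -(phiG g x y Gg) -(card_orbit_map y x Gg) gx gy.
Qed.

End Weights.

(** * The weighted Cheeger inequality *)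

Lemma argmin_seq (R : realType) (T : eqType) (a : T -> R) (F : seq T) :
  F != [::] -> exists2 x, x \in F & forall y, y \in F -> a x <= a y.
Proof.
elim: F => // x F IH _; have [->|/IH[y yF ymin]] := eqVneq F [::].
  by exists x; rewrite ?mem_head// => y; rewrite inE => /eqP ->.
have [xy|yx] := leP (a x) (a y).
  exists x; rewrite ?mem_head// => z; rewrite inE => /predU1P[->//|/ymin].
  exact: le_trans.
exists y; first by rewrite inE yF orbT.
by move=> z; rewrite inE => /predU1P[->|/ymin//]; exact: ltW.
Qed.

Section Cheeger.
Variables (R : realType) (V : choiceType) (e : V -> V -> Prop).
Hypothesis e_sym : forall x y, e x y -> e y x.
Hypothesis e_fin : forall x, finite_set (e x).
Variables (w r : V -> R) (d k c0 : R).
Hypothesis r_gt0 : forall x, 0 < r x.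
Hypothesis rE : forall x, r x ^+ 2 = w x.
Hypothesis r_eig : forall x, nsum e r x = d * r x.
Hypothesis k_gt0 : 0 < k.
Hypothesis kP : forall x y, e x y -> k * w y <= r x * r y.
Hypothesis c0_gt0 : 0 < c0.

Let bd (F : seq V) : set V := [set y | y \notin F /\ exists2 x, x \in F & e x y].
Hypothesis expand : forall F : seq V, uniq F -> F != [::] ->
  c0 * \sum_(x <- F) w x <= \sum_(y <- fset_set (bd F)) w y.

Let w_gt0 x : 0 < w x. Proof. by rewrite -rE exprn_gt0. Qed.

Let bd_fin F : finite_set (bd F).
Proof.
apply: (@sub_finite_set _ _ (\bigcup_(x in [set` F]) e x)).
  by move=> y [_ [x xF xy]]; exists x.
exact: bigcup_finite.
Qed.

(** One edge into each boundary vertex already has conductance at least [k] times the weight of that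
    vertex, so vertex expansion implies edge expansion. *)
Let edge_expand (s' F : seq V) : uniq s' -> uniq F -> F != [::] ->
  {subset F <= s'} -> (forall x y, x \in F -> e x y -> y \in s') ->
  k * c0 * \sum_(x <- s' | x \in F) w x <=
  \sum_(x <- s') \sum_(y <- s' | `[< e x y >])
    r x * r y * ((x \in F) && (y \notin F))%:R.
Proof.
move=> us' uF F0 Fs' nF.
have -> : \sum_(x <- s' | x \in F) w x = \sum_(x <- F) w x.
  rewrite -big_filter; apply: perm_big; apply: uniq_perm => //.
    exact: filter_uniq.
  by move=> x; rewrite mem_filter; case: (boolP (x \in F)) => // /Fs' ->.
rewrite -mulrA; apply: (le_trans (ler_wpM2l (ltW k_gt0) (expand uF F0))).
rewrite mulr_sumr.
have -> : \sum_(y <- fset_set (bd F)) k * w y =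
    \sum_(y <- s') (if `[< bd F y >] then k * w y else 0).
  rewrite -big_mkcond -[RHS]big_filter; apply: perm_big; apply: uniq_perm.
  - exact: fset_uniq.
  - exact: filter_uniq.
  move=> y; rewrite mem_filter in_fset_set//.
  have -> : (y \in bd F) = `[< bd F y >] by apply/idP/asboolP; rewrite in_setE.
  by case: asboolP => //= -[_ [x xF xy]]; rewrite (nF x).
under [leRHS]eq_bigr do rewrite big_mkcond.
rewrite exchange_big; apply: ler_sum => y _.
case: asboolP => [[yF [x xF xy]]|_]; last first.
  apply: sumr_ge0 => x _; case: ifP => // _.
  by rewrite !mulr_ge0// ltW.
rewrite (bigD1_seq x) ?Fs'//= asboolT// xF yF mulr1.
rewrite -[leLHS]addr0 lerD ?kP//; apply: sumr_ge0 => z _; case: ifP => // _.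
by rewrite !mulr_ge0// ltW.
Qed.

(* Layer-cake induction: subtracting from [a] its least positive value times
   the indicator of its support leaves the slopes across edges inside the
   support unchanged. *)
Let coarea (s s' : seq V) (a : V -> R) : uniq s' -> {subset s <= s'} ->
  (forall x y, x \in s -> e x y -> y \in s') ->
  (forall x, 0 <= a x) -> (forall x, a x != 0 -> x \in s) ->
  k * c0 * \sum_(x <- s') w x * a x <=
  \sum_(x <- s') \sum_(y <- s' | `[< e x y >])
    r x * r y * Num.max (a x - a y) 0.
Proof.
move=> us' ss' ns'; have [n] := ubnP (count (fun x => a x != 0) s').
elim: n a => // n IH a; rewrite ltnS => an a0 supp.
set F := [seq x <- s' | a x != 0].
have uF : uniq F by exact: filter_uniq.
have Fs' : {subset F <= s'} by move=> x; rewrite mem_filter => /andP[].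
have memF x : (x \in F) = (a x != 0).
  by rewrite mem_filter; case: eqP => //= /eqP /supp /ss' ->.
have [F0|F0] := eqVneq F [::].
  have az x : a x = 0 by apply/eqP/negPn; rewrite -memF F0.
  rewrite big1 ?mulr0; last by move=> x _; rewrite az mulr0.
  apply: sumr_ge0 => x _; apply: sumr_ge0 => y _; rewrite !mulr_ge0 ?(ltW (r_gt0 _))//.
  by rewrite le_max lexx orbT.
have [x0 x0F x0min] := argmin_seq a F0.
set m := a x0.
have m0 : 0 < m by rewrite lt0r a0 -memF x0F.
pose a' x := if x \in F then a x - m else 0.
have a'0 x : 0 <= a' x by rewrite /a'; case: ifP => // /x0min; rewrite subr_ge0.
have IHa : k * c0 * (\sum_(x <- s') w x * a' x) <=
    \sum_(x <- s') \sum_(y <- s' | `[< e x y >])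
      r x * r y * Num.max (a' x - a' y) 0.
  apply: IH => //; last first.
    by move=> x; rewrite /a' memF; case: ifP => [/supp//|_]; rewrite eqxx.
  apply: leq_trans an; rewrite -!size_filter -/F.
  have /perm_size -> : perm_eq F (x0 :: rem x0 F) by exact: perm_to_rem.
  rewrite ltnS; apply: uniq_leq_size; first exact: filter_uniq.
  move=> x; rewrite mem_filter mem_rem_uniq// inE /a' => /andP[+ _].
  case: ifP => [xF am|_]; last by rewrite eqxx.
  rewrite andbT; apply: contraNneq am => ->; rewrite /= subrr.
  by [].
have wE : \sum_(x <- s') w x * a x =
    m * (\sum_(x <- s' | x \in F) w x) + \sum_(x <- s') w x * a' x.
  rewrite [X in m * X]big_mkcond mulr_sumr -big_split/=; apply: eq_bigr => x _.
  rewrite /a' memF; case: eqP => [->|_] /=; lra.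
have mE x y : Num.max (a x - a y) 0 =
    m * ((x \in F) && (y \notin F))%:R + Num.max (a' x - a' y) 0.
  rewrite /a'; case: (boolP (x \in F)) => xF; case: (boolP (y \in F)) => yF /=.
  - by rewrite mulr0 add0r; congr Num.max; lra.
  - move: yF; rewrite memF negbK => /eqP ->.
    have := x0min _ xF; rewrite -/m => h.
    by rewrite !max_l; lra.
  - move: xF; rewrite memF negbK => /eqP ->.
    have := x0min _ yF; rewrite -/m => h.
    by rewrite !max_r; lra.
  - move: xF yF; rewrite !memF !negbK => /eqP -> /eqP ->.
    by rewrite mulr0 subrr add0r.
have -> : \sum_(x <- s') \sum_(y <- s' | `[< e x y >])
      r x * r y * Num.max (a x - a y) 0 =
    m * (\sum_(x <- s') \sum_(y <- s' | `[< e x y >])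
      r x * r y * ((x \in F) && (y \notin F))%:R) +
    \sum_(x <- s') \sum_(y <- s' | `[< e x y >])
      r x * r y * Num.max (a' x - a' y) 0.
  rewrite mulr_sumr -big_split/=; apply: eq_bigr => x _.
  rewrite mulr_sumr -big_split/=; apply: eq_bigr => y _.
  by rewrite mE; lra.
rewrite wE mulrDr lerD// mulrCA ler_pM2l//.
apply: edge_expand => // x y xF; apply: ns'; apply: supp.
by rewrite -memF.
Qed.

(** Ground-state substitution: with [f = r * g] the gap [d |f|^2 - <f, A f>] is the Dirichlet form
    of [g] for the conductances [r x * r y], and the co-area bound is applied to [g ^+ 2]. *)
Lemma cheeger_form : 0 < d ->
  form_bound e (d - (k * c0) ^+ 2 / (8 * d)).
Proof.
move=> d0 s f us f0; set h := k * c0; have h0 : 0 < h by rewrite mulr_gt0.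
have fU : finite_set ([set` s] `|` \bigcup_(x in [set` s]) e x).
  by rewrite finite_setU; split=> //; apply: bigcup_finite.
(* The neighbours of [s] are included so that the eigenvalue equation holds inside [s'] at each
   vertex of [s]. *)
pose s' : seq V := fset_set ([set` s] `|` \bigcup_(x in [set` s]) e x).
have us' : uniq s' by exact: fset_uniq.
have ss' : {subset s <= s'}.
  by move=> x xs; rewrite /s' in_fset_set// in_setE; left.
have ns' x y : x \in s -> e x y -> y \in s'.
  by move=> xs xy; rewrite /s' in_fset_set// in_setE; right; exists x.
pose p x := f x * (x \in s)%:R.
pose g x := p x / r x.
have pE x : p x = r x * g x by rewrite /g mulrC divfK// lt0r_neq0.
have p0 x : 0 <= p x by rewrite /p mulr_ge0.
have g0 x : 0 <= g x by rewrite /g divr_ge0// ltW.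
have sub (F : V -> R) : \sum_(x <- s') F x * (x \in s)%:R = \sum_(x <- s) F x.
  rewrite (eq_bigr (fun x => if x \in s then F x else 0)); last first.
    by move=> x _; case: ifP; rewrite ?mulr1 ?mulr0.
  rewrite -big_mkcond -big_filter; apply: perm_big; apply: uniq_perm => //.
    exact: filter_uniq.
  by move=> x; rewrite mem_filter; case: (boolP (x \in s)) => // /ss' ->.
set S2 := \sum_(x <- s) f x ^+ 2.
have S2E : \sum_(x <- s') p x ^+ 2 = S2.
  rewrite /S2 -sub; apply: eq_bigr => x _.
  by rewrite /p exprMn; case: (x \in s); rewrite ?expr1n ?expr0n.
set Q := \sum_(x <- s) _.
have QE : \sum_(x <- s') \sum_(y <- s' | `[< e x y >]) p x * p y = Q.
  rewrite /Q -sub; apply: eq_bigr => x _.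
  rewrite mulr_suml big_mkcond [RHS]big_mkcond /= -[RHS]sub.
  apply: eq_bigr => y _; rewrite /p; case: ifP => _; last by rewrite mul0r.
  by case: (x \in s) (y \in s) => -[]; rewrite ?mulr0 ?mulr1 ?mul0r.
have PE : \sum_(x <- s') \sum_(y <- s' | `[< e x y >]) r x * r y * g x ^+ 2 = d * S2.
  rewrite -S2E mulr_sumr; apply: eq_bigr => x _.
  have [xs|xs] := boolP (x \in s); last first.
    have px : p x = 0 by rewrite /p (negbTE xs) mulr0.
    rewrite px expr0n mulr0 big1// => y _.
    by rewrite /g px mul0r expr0n mulr0.
  rewrite pE (_ : d * _ = (d * r x) * (r x * g x ^+ 2)); last by lra.
  rewrite -r_eig (nsum_filter e_fin _ us'); last by move=> y; exact: ns'.
  by rewrite mulr_suml; apply: eq_bigr => y _; lra.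
have PE' : \sum_(x <- s') \sum_(y <- s' | `[< e x y >]) r x * r y * g y ^+ 2 = d * S2.
  rewrite -PE; under eq_bigr do rewrite big_mkcond.
  under [RHS]eq_bigr do rewrite big_mkcond.
  rewrite exchange_big; apply: eq_bigr => x _; apply: eq_bigr => y _.
  rewrite (mulrC (r x)); suff -> : `[< e x y >] = `[< e y x >] by [].
  by apply/asboolP/asboolP; exact: e_sym.
(* This [t] minimizes [2 * d * t ^+ 2 - h * t]; the minimum is [- h ^+ 2 / (8 * d)]. *)
pose t := h / (4 * d); have t0 : 0 < t by rewrite divr_gt0// mulr_gt0.
have td : 4 * d * t = h by rewrite /t mulrC divfK// lt0r_neq0// mulr_gt0.
have key : t * (h * S2) <= (1 / 2 + t ^+ 2) * (d * S2 + d * S2) - Q.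
  have -> : S2 = \sum_(x <- s') w x * g x ^+ 2.
    rewrite -S2E; apply: eq_bigr => x _; rewrite -rE pE; lra.
  have gs x : g x ^+ 2 != 0 -> x \in s.
    by rewrite /g /p; case: (x \in s) => //; rewrite mulr0 mul0r expr0n eqxx.
  have := coarea us' ss' ns' (fun x => sqr_ge0 _) gs.
  move=> /(ler_wpM2l (ltW t0))/le_trans; apply.
  have -> : \sum_(x <- s') w x * g x ^+ 2 = S2.
    rewrite -S2E; apply: eq_bigr => x _; rewrite -rE pE; lra.
  rewrite -{1}PE -PE' -QE -big_split/= !mulr_sumr -sumrB; apply: ler_sum => x _.
  rewrite -big_split/= !mulr_sumr -sumrB; apply: ler_sum => y _.
  rewrite !pE; have c_ge0 : 0 <= r x * r y by rewrite mulr_ge0// ltW.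
  move: (r x) (r y) c_ge0 (g0 x) (g0 y) => rx ry c_ge0.
  move: (g x) (g y) => u v u0 v0.
  (* An arithmetic-geometric mean bound in place of Cauchy-Schwarz: twice the difference of the two
     sides is the sum of the two squares below. *)
  have h1 : t * (u ^+ 2 - v ^+ 2) <= (1/2 + t ^+ 2) * (u ^+ 2 + v ^+ 2) - u * v.
    have := sqr_ge0 ((u - v) - t * (u + v)); have := sqr_ge0 (t * (u - v)); nra.
  have h2 : 0 <= (1/2 + t ^+ 2) * (u ^+ 2 + v ^+ 2) - u * v.
    have := sqr_ge0 (u - v); have := sqr_ge0 (t * u); have := sqr_ge0 (t * v); nra.
  have {h1 h2} : t * Num.max (u ^+ 2 - v ^+ 2) 0 <=
      (1/2 + t ^+ 2) * (u ^+ 2 + v ^+ 2) - u * v.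
    by rewrite /Num.max; case: ifP => _; rewrite ?mulr0.
  by move: (Num.max _ _) => M /(ler_wpM2l c_ge0); lra.
have -> : h ^+ 2 / (8 * d) = t * h / 2.
  have -> : h ^+ 2 = t * h / 2 * (8 * d) by rewrite expr2 -{1}td; lra.
  by rewrite mulfK// lt0r_neq0// mulr_gt0.
move: key; rewrite -td; move: S2 Q {S2E QE PE PE'} => S2 Q; nra.
Qed.

End Cheeger.

(** * Level sets of walk counts *)

Lemma pigeonhole_sum (R : realType) (I : finType) (F : I -> R) (K : R) :
  0 < K -> K <= \sum_i F i -> exists i, K <= #|I|%:R * F i.
Proof.
move=> K0 KF; apply: contrapT => /forallNP H.
have I0 : (0 < #|I|)%N.
  rewrite lt0n; apply/eqP => I0; move: KF; rewrite leNgt big1 ?K0// => i _.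
  by have := fintype0 i I0.
have : \sum_i #|I|%:R * F i < \sum_(i : I) K.
  apply: ltr_sum => [|i _]; first by apply/hasP; exists (enum_val (Ordinal I0)); rewrite ?mem_index_enum.
  by rewrite ltNge; apply/negP; exact: H.
rewrite -mulr_sumr sumr_const -[K *+ _]mulr_natl ltr_pM2l ?ltr0n// => /lt_le_trans/(_ KF).
by rewrite ltxx.
Qed.

Section LevelSets.
Variables (R : realType) (V : choiceType) (e : V -> V -> Prop).
Variables (Gamma : set (V -> V)) (o : V).
Hypothesis e_sym : forall x y, e x y -> e y x.
Hypothesis e_fin : forall x, finite_set (e x).
Hypothesis Gamma_id : Gamma id.
Hypothesis Gamma_comp : forall g h, Gamma g -> Gamma h -> Gamma (g \o h).
Hypothesis Gamma_inv : forall g, Gamma g ->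
  exists h, [/\ Gamma h, cancel g h & cancel h g].
Hypothesis Gamma_tr : forall x y, exists2 g, Gamma g & g x = y.
Hypothesis orbit_fin : forall x y, finite_set (stab_orbit Gamma x y).
Hypothesis e_map : forall g x y, Gamma g -> e x y -> e (g x) (g y).

Local Notation W := (rel_weight R Gamma).
Local Notation T := (@nsum R V e).
Let r x : R := Num.sqrt (W o x).
Let w_gt0 x y : 0 < W x y. Proof. exact: weight_gt0. Qed.
Let r_gt0 x : 0 < r x. Proof. by rewrite sqrtr_gt0. Qed.

Lemma perm_nb_map g x : Gamma g ->
  perm_eq (fset_set (e (g x))) [seq g y | y <- fset_set (e x)].
Proof.
move=> Gg; have [h [Gh gh hg]] := Gamma_inv Gg.
apply: uniq_perm; first exact: fset_uniq.
  by rewrite map_inj_uniq ?fset_uniq//; exact: can_inj gh.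
move=> y; rewrite mem_nb//; apply/asboolP/mapP => [xy|[z + ->]].
  exists (h y); last by rewrite hg.
  by rewrite mem_nb//; apply/asboolP; have := e_map Gh xy; rewrite gh.
by rewrite mem_nb// => /asboolP/(e_map Gg).
Qed.

Lemma iter_nsum_map n g f x : Gamma g ->
  iter n T f (g x) = iter n T (f \o g) x.
Proof.
move=> Gg; elim: n x => [//|n IH] x /=.
rewrite /nsum (perm_big _ (perm_nb_map x Gg)) big_map.
by apply: eq_bigr => y _; rewrite IH.
Qed.

Lemma cnt_map n g x y : Gamma g -> cnt e n (g x) (g y) = cnt e n x y.
Proof.
move=> Gg; apply/eqP; rewrite -(eqr_nat R) !cntE// iter_nsum_map//; apply/eqP.
apply: eq_iter_nsum => // z _ /=; congr (_ %:R).
by rewrite (inj_eq (Gamma_inj Gamma_inv Gg)).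
Qed.

Lemma sqrt_weight_map g y : Gamma g -> r (g y) = r (g o) * r y.
Proof.
move=> Gg; rewrite /r -sqrtrM; last exact: ltW.
by rewrite -(weight_map _ Gamma_comp Gamma_inv orbit_fin o y Gg) -weight_cocycle.
Qed.

(** Moving by [g] multiplies [r] by the constant [r (g o)], so the eigenvalue equation at [o] is
    carried to every vertex. *)
Lemma nsum_sqrt_weight x : T r x = T r o * r x.
Proof.
have [g Gg <-] := Gamma_tr o x.
have := iter_nsum_map 1 r o Gg; rewrite /= => ->; rewrite /nsum mulr_suml.
by apply: eq_bigr => y _ /=; rewrite sqrt_weight_map// mulrC.
Qed.

Lemma iter_nsum_sqrt_weight n : iter n T r o = T r o ^+ n.
Proof.
have ro : r o = 1 by rewrite /r weight_id// sqrtr1.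
suff H x : iter n T r x = T r o ^+ n * r x by rewrite H ro mulr1.
elim: n x => [|n IH] x; first by rewrite expr0 mul1r.
rewrite iterS (@eq_nsum _ _ _ e_fin _ (fun z => T r o ^+ n * r z))//.
have /= -> := iter_nsumZ e_fin (T r o ^+ n) r 1 x.
by rewrite (nsum_sqrt_weight x) exprSr mulrA.
Qed.

Let q := size (fset_set (e o)).
Let lvl (v : R) (x : V) : R := r x * (W o x == v)%:R.
(** This is [d ^+ n] times the probability that the tilted walk from [o] has weight [v] at time
    [n]. *)
Let M n v := iter n T (lvl v) o.

Lemma lvl_ge0 v x : 0 <= lvl v x.
Proof. by rewrite mulr_ge0// ltW. Qed.

(** Carried back to [o] by the group, each step multiplies the weight by that of a neighbour of [o].
    Multiplication is commutative, so only the number of uses of each neighbour matters. *)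
Lemma walk_weight n y : walk e o y n ->
  exists c : 'I_q -> nat, (forall j, (c j <= n)%N) /\
    W o y = \prod_(j < q) W o (nth o (fset_set (e o)) j) ^+ c j.
Proof.
elim: n y => [|n IH] y.
  move=> /walk0 <-; exists (fun=> 0%N); split=> //.
  by rewrite big1 ?weight_id.
move=> /walkSr[z /IH[c [cn wz]] zy].
have [g Gg gz] := Gamma_tr o z; have [h [Gh gh hg]] := Gamma_inv Gg.
have oy' : h y \in fset_set (e o).
  by rewrite mem_nb//; apply/asboolP; have := e_map Gh zy; rewrite -gz gh.
have iq : (index (h y) (fset_set (e o)) < q)%N by rewrite index_mem.
exists (fun j => (c j + (j == Ordinal iq))%N); split.
  by move=> j; rewrite -[n.+1]addn1 leq_add// leq_b1.
under eq_bigr do rewrite exprD.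
rewrite big_split/= -wz (bigD1 (Ordinal iq))//= eqxx expr1 nth_index//.
rewrite big1 ?mulr1; last by move=> j /negbTE ->.
rewrite (weight_cocycle _ Gamma_id Gamma_comp Gamma_inv orbit_fin o z y); congr (_ * _).
by rewrite -(weight_map _ Gamma_comp Gamma_inv orbit_fin o (h y) Gg) gz hg.
Qed.

(** Polynomial growth: by [walk_weight] the weight at time [n] is coded by multiplicities in
    [{0, ..., n}], one for each of the [q] neighbours. Different codes may give the same weight,
    which only enlarges the sum. *)
Lemma level_pigeonhole n : 0 < T r o -> exists2 v, 0 < v &
  T r o ^+ n <= (n.+1 ^ q)%:R * M n v.
Proof.
move=> d0; pose val (c : {ffun 'I_q -> 'I_n.+1}) : R :=
  \prod_(j < q) W o (nth o (fset_set (e o)) j) ^+ c j.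
have val0 c : 0 < val c by apply: prodr_gt0 => j _; rewrite exprn_gt0.
have [||c Hc] := @pigeonhole_sum R _ (fun c => M n (val c)) (T r o ^+ n).
- by rewrite exprn_gt0.
- rewrite -iter_nsum_sqrt_weight.
  apply: (@le_trans _ _ (iter n T (fun z => \sum_(c <- enum {ffun 'I_q -> 'I_n.+1}) 1 * lvl (val c) z) o)).
    apply: iter_nsum_le => // y /walk_weight[c [cn wy]].
    pose c' : {ffun 'I_q -> 'I_n.+1} := [ffun j => inord (c j)].
    have c'P : W o y = val c'.
      by rewrite wy /val; apply: eq_bigr => j _; rewrite ffunE inordK// ltnS.
    rewrite (bigD1_seq c') ?mem_enum ?enum_uniq//= mul1r /lvl c'P eqxx mulr1.
    rewrite -c'P lerDl; apply: sumr_ge0 => i _.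
    by rewrite mul1r lvl_ge0.
  rewrite iter_nsum_sum// big_enum/=.
  by apply: ler_sum => c _; rewrite mul1r.
exists (val c) => //; move: Hc.
by rewrite card_ffun !card_ord.
Qed.

(** Symmetry of the weight process. Reversing a walk inverts the weight ratio, and the factor
    supplied by mass transport turns the square root of the inverse weight back into [r]. *)
Lemma level_dual n (v : R) : 0 < v -> M n v^-1 = M n v.
Proof.
move=> v0.
have fW x : finite_set (walk e x ^~ n) by exact: finite_walk.
have ME u : M n u = \sum_(y <- fset_set (walk e o ^~ n)) lvl u y * (cnt e n o y)%:R.
  apply: (iter_nsum_cnt e_fin); first exact: fset_uniq.
  move=> y oy; rewrite in_fset_set//; move/negP; rewrite in_setE.
  by move/(_ oy).
pose phi x y : R := Num.sqrt (W x y) * (W x y == v^-1)%:R * (cnt e n x y)%:R.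
have wS x y : walk e x y n -> walk e y x n by exact: walk_sym.
have SE : (fun x => walk e x o n) = (walk e o ^~ n).
  by apply/seteqP; split=> x; exact: wS.
have := @mass_transport R V Gamma Gamma_id Gamma_comp Gamma_inv Gamma_tr orbit_fin
  (fun x y => walk e x y n) phi o _ _ (fW o).
rewrite SE => /(_ _ _ (fW o)) H.
rewrite !ME [LHS](_ : _ = \sum_(y <- fset_set (walk e o ^~ n)) phi o y)// H.
- apply: eq_bigr => y _; rewrite /phi /lvl /r (cnt_sym e_fin e_sym n y o).
  rewrite (weight_sym _ Gamma_id Gamma_comp Gamma_inv orbit_fin o y).
  rewrite (inj_eq invr_inj) sqrtrV ?ltW//.
  have {3}-> : W o y = Num.sqrt (W o y) * Num.sqrt (W o y).
    by rewrite -expr2 sqr_sqrtr// ltW.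
  have := r_gt0 y; rewrite /r; move: (Num.sqrt _) => t t0.
  rewrite mulrAC; congr (_ * _); rewrite mulrAC mulrA mulVf ?mul1r//.
  by rewrite lt0r_neq0.
- by move=> g x y Gg; apply: walk_map => ? ?; exact: e_map.
- by move=> g x y Gg; rewrite /phi cnt_map// weight_map.
Qed.

(** Reach weight [v] in [n] steps, then multiply the weight by [v^-1] in [n] more; by [level_dual]
    both halves have the same mass. *)
Lemma level_square n (v : R) : 0 < v -> M n v ^+ 2 <= M (n + n) 1.
Proof.
move=> v0; rewrite {2}/M iterD.
have H z : W o z = v -> iter n T (lvl 1) z = r z * M n v.
  move=> wz; have [g Gg gz] := Gamma_tr o z.
  rewrite -(level_dual n v0) /M -iter_nsumZ// -gz iter_nsum_map//.
  apply: eq_iter_nsum => // y _ /=; rewrite /lvl sqrt_weight_map// -mulrA.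
  congr (_ * (_ * _%:R)); congr nat_of_bool.
  rewrite (weight_cocycle _ Gamma_id Gamma_comp Gamma_inv orbit_fin o z (g y)).
  rewrite -{2}gz (weight_map _ Gamma_comp Gamma_inv orbit_fin o y Gg) wz.
  apply/eqP/eqP => [h|->]; last by rewrite divff// lt0r_neq0.
  by apply: (mulfI (lt0r_neq0 v0)); rewrite h divff// lt0r_neq0.
rewrite expr2 {2}/M -iter_nsumZ//; apply: iter_nsum_le => // z _.
rewrite /lvl; case: eqP => [/H ->|_]; first by rewrite mulr1 mulrC.
rewrite !mulr0; have := @iter_nsum_le R V e e_fin n (fun=> 0) (lvl 1) z.
rewrite (_ : iter n T (fun=> 0) z = 0); first by apply=> y _; exact: lvl_ge0.
elim: (n) z => //= k IH z; rewrite /nsum big1_seq// => y _; exact: IH.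
Qed.

Lemma size_nb x : size (fset_set (e x)) = q.
Proof.
have [g Gg <-] := Gamma_tr o x.
by rewrite (perm_size (perm_nb_map o Gg)) size_map.
Qed.

Lemma iter_nsum1 n x : iter n T (fun=> 1) x = (q ^ n)%:R.
Proof.
elim: n x => [//|n IH] x /=; rewrite (@eq_nsum _ _ _ e_fin _ (fun=> (q ^ n)%:R))//.
rewrite /nsum big_const_seq count_predT size_nb expnS mulnC natrM.
by rewrite iter_addr_0 mulr_natr.
Qed.

Lemma cnt_leq n x y : (cnt e n x y <= q ^ n)%N.
Proof.
rewrite -(ler_nat R) cntE// -(iter_nsum1 n x); apply: iter_nsum_le => // z _.
by rewrite lern1 leq_b1.
Qed.

(** The walk condition matters at level [0]: since [trunc_log 2 0 = 0], that level would otherwise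
    contain vertices that no walk of length [n] reaches. *)
Definition level_rel (n i : nat) (x y : V) : Prop :=
  [/\ W x y = 1, walk e x y n & trunc_log 2 (cnt e n x y) = i].

Lemma finite_level_rel n i x : finite_set (level_rel n i x).
Proof. by apply: sub_finite_set (finite_walk x n e_fin) => y []. Qed.

Lemma sum_level_cnt n i :
  \sum_(y <- fset_set (level_rel n i o)) (cnt e n o y)%:R =
  iter n T (fun y => `[< level_rel n i o y >]%:R) o.
Proof.
have fS := finite_level_rel n i o.
rewrite (@iter_nsum_cnt R V e e_fin (fset_set (level_rel n i o)))//.
- by apply: eq_big_seq => y; rewrite in_fset_set// in_setE => /asboolT ->; rewrite mul1r.
move=> y _; rewrite in_fset_set//; case: asboolP => // yS.
by rewrite notin_setE => /(_ yS).
Qed.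

Lemma level_rel_pigeonhole n : 0 < T r o -> exists i,
  T r o ^+ (n + n) <= (n.+1 ^ (q + q) * (q * (n + n)).+1)%:R *
    \sum_(y <- fset_set (level_rel (n + n) i o)) (cnt e (n + n) o y)%:R.
Proof.
move=> d0; have [v v0 Hv] := level_pigeonhole n d0.
have HM : T r o ^+ (n + n) <= (n.+1 ^ (q + q))%:R * M (n + n) 1.
  have M0 : 0 <= T r o ^+ n by rewrite exprn_ge0// ltW.
  apply: le_trans (_ : (n.+1 ^ (q + q))%:R * M n v ^+ 2 <= _).
    rewrite exprD expnD natrM expr2 mulrACA; exact: ler_pM.
  by apply: ler_wpM2l => //; exact: level_square.
have M0 : 0 < M (n + n) 1.
  have := lt_le_trans (exprn_gt0 (n + n) d0) HM.
  by rewrite pmulr_rgt0// ltr0n expn_gt0.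
(* Counts are at most [q ^ (n + n)] and [q < 2 ^ q], so these [L] levels exhaust all dyadic
   sizes. *)
set L := (q * (n + n)).+1.
have [||i Hi] := @pigeonhole_sum R _ (fun i : 'I_L =>
  iter (n + n) T (fun y => `[< level_rel (n + n) i o y >]%:R) o) (M (n + n) 1) => //.
  apply: le_trans (_ : iter (n + n) T (fun z => \sum_(i <- enum 'I_L) 1 *
      `[< level_rel (n + n) i o z >]%:R) o <= _); last first.
    by rewrite iter_nsum_sum// big_enum/=; apply: ler_sum => i _; rewrite mul1r.
  apply: iter_nsum_le => // y oy; rewrite /lvl; case: eqP => [w1|_]; last first.
    by rewrite mulr0; apply: sumr_ge0 => i _; rewrite mul1r.
  have iL : (trunc_log 2 (cnt e (n + n) o y) < L)%N.
    rewrite ltnS -(@trunc_expnK 2 (q * (n + n)))//; apply: leq_trunc_log.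
    apply: (leq_trans (cnt_leq _ _ _)); rewrite expnM.
    by case: (n + n)%N => // k; rewrite leq_exp2r// ltnW// ltn_expl.
  rewrite (bigD1_seq (Ordinal iL)) ?mem_enum ?enum_uniq//= asboolT//.
  rewrite mul1r /r w1 sqrtr1 mulr1 lerDl; apply: sumr_ge0 => i _.
  by rewrite mul1r.
exists i; apply: (le_trans HM); rewrite natrM -mulrA; apply: ler_wpM2l => //.
by rewrite sum_level_cnt; rewrite card_ord in Hi.
Qed.

Lemma card_level_rel n i : (#|` fset_set (level_rel n i o)| <= q ^ n)%N.
Proof.
rewrite -(ler_nat R) -(iter_nsum1 n o).
apply: le_trans (_ : \sum_(y <- fset_set (level_rel n i o)) (cnt e n o y)%:R <= _).
  rewrite -sum1_size natr_sum big_seq [leRHS]big_seq; apply: ler_sum => y.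
  rewrite in_fset_set ?in_setE; last exact: finite_level_rel.
  by move=> [_ oy _]; rewrite ler1n walk_cnt.
rewrite sum_level_cnt; apply: iter_nsum_le => // y _.
by rewrite lern1 leq_b1.
Qed.

End LevelSets.

(** * Percolation events *)

Section MeasurablePredicates.
Context {d : measure_display} {T : measurableType d}.
Implicit Types P Q : T -> Prop.

Lemma measurable_exists (U : Type) (P : U -> T -> Prop) :
  countable [set: U] -> (forall u, measurable [set w | P u w]) ->
  measurable [set w | exists u, P u w].
Proof.
move=> Uc mP; rewrite (_ : mkset _ = \bigcup_u [set w | P u w]).
  exact: countable_bigcupT_measurable.
by apply/seteqP; split=> w /= [u]; [exists u|exists u].
Qed.

Lemma measurable_not P : measurable [set w | P w] -> measurable [set w | ~ P w].
Proof. exact: measurableC. Qed.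

Lemma measurable_forall (U : Type) (P : U -> T -> Prop) :
  countable [set: U] -> (forall u, measurable [set w | P u w]) ->
  measurable [set w | forall u, P u w].
Proof.
move=> Uc mP; rewrite (_ : mkset _ = [set w | ~ exists u, ~ P u w]).
  by apply: measurable_not; apply: measurable_exists => // u; exact: measurable_not.
by apply/seteqP; split=> w /=; [move=> H [u]; exact|move=> /forallNP H u; exact: contrapT].
Qed.

Lemma measurable_and P Q : measurable [set w | P w] -> measurable [set w | Q w] ->
  measurable [set w | P w /\ Q w].
Proof. exact: measurableI. Qed.

Lemma measurable_imply P Q : measurable [set w | P w] -> measurable [set w | Q w] ->
  measurable [set w | P w -> Q w].
Proof.
move=> mP mQ; rewrite (_ : mkset _ = ~` [set w | P w] `|` [set w | Q w]).
  by apply: measurableU => //; exact: measurableC.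
apply/seteqP; split=> w /=; last by case.
by case: (pselect (P w)) => [p /(_ p)|]; [right|left].
Qed.

Lemma measurable_cstP (X : Prop) : measurable [set _ : T | X].
Proof.
case: (pselect X) => x.
  by rewrite (_ : mkset _ = setT)//; apply/seteqP; split.
by rewrite (_ : mkset _ = set0)//; apply/seteqP; split.
Qed.

End MeasurablePredicates.

Lemma countable_seq (V : choiceType) : countable [set: V] -> countable [set: seq V].
Proof.
move=> /countable_injP[f fI]; apply/countable_injP.
exists (fun s => choice.pickle [seq f i | i <- s]) => s t _ _ /(pcan_inj choice.pickleK).
by apply: inj_map => x y; apply: fI; rewrite inE.
Qed.

(** On a countable vertex set there are countably many lists, so this form expresses infinitude by
    countable operations on connection events. *)
Lemma infinite_setP (V : choiceType) (A : set V) :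
  infinite_set A <-> forall s : seq V, exists x, A x /\ x \notin s.
Proof.
split=> [iA s|H fA].
  apply: contrapT => /forallNP H; apply: iA.
  apply: (sub_finite_set _ (finite_seq s)) => x Ax /=.
  by apply: contrapT => /negP xs; apply: (H x).
have [x [Ax]] := H (fset_set A).
by rewrite in_fset_set// notin_setE; apply.
Qed.

Lemma set2_eq (V : Type) (x y u v : V) : [set x; y] = [set u; v] ->
  (x = u /\ y = v) \/ (x = v /\ y = u).
Proof.
move=> E; have : [set u; v] x by rewrite -E; left.
have : [set u; v] y by rewrite -E; right.
have : [set x; y] u by rewrite E; left.
have : [set x; y] v by rewrite E; right.
by move=> [] ? [] ? [] ? [] ?; subst; first [by left|by right].
Qed.

Section PercolationEvents.
Variables (V : choiceType) (G : graph V).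
Hypothesis Vc : countable [set: V].
Local Notation C := (config_space G).

Lemma open_adjE (w : config G) (e : edge G) x y : sval e = [set x; y] ->
  open_adj w x y <-> w e = true.
Proof.
move=> exy; split=> [[e' we' e'xy]|we]; last by exists e.
rewrite -we'; congr w; apply: eq_sig_hprop; first by move=> *; exact: Prop_irrelevance.
by rewrite exy e'xy.
Qed.

Lemma open_adj_adj (w : config G) x y : open_adj w x y -> adj G x y.
Proof.
move=> [[e He] _ /= exy]; have [u [v [uv euv]]] := He.
have [[-> ->]//|[-> ->]] := set2_eq (etrans (esym exy) euv).
exact: adj_sym.
Qed.

Lemma open_adj_sym (w : config G) x y : open_adj w x y -> open_adj w y x.
Proof. by move=> [e we exy]; exists e => //; rewrite exy setUC. Qed.

Lemma exists_edge x y : adj G x y -> exists e : edge G, sval e = [set x; y].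
Proof. by move=> xy; exists (exist _ [set x; y] (ex_intro _ x (ex_intro _ y (conj xy erefl)))). Qed.

Lemma measurable_open_adj x y : measurable [set w : C | open_adj (w : config G) x y].
Proof.
case: (pselect (adj G x y)) => [/exists_edge[e exy]|nxy].
  rewrite (_ : mkset _ = [set w : config G | w e = true]).
    by apply: sub_sigma_algebra; exists e, true.
  by apply/seteqP; split=> w /=; rewrite (open_adjE _ exy).
rewrite (_ : mkset _ = set0)//; apply/seteqP; split=> w //=.
by move/open_adj_adj.
Qed.

Lemma measurable_component x y :
  measurable [set w : C | component (open_adj (w : config G)) x y].
Proof.
rewrite (_ : mkset _ = [set w : C | exists n, walk (open_adj (w : config G)) x y n])//.
apply: measurable_exists => // n; elim: n x => [|n IH] x.
  rewrite (_ : mkset _ = [set _ | x = y]); first exact: measurable_cstP.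
  by apply/seteqP; split=> w /=; rewrite walk0.
rewrite (_ : mkset _ = [set w : C | exists z, open_adj (w : config G) x z /\
    walk (open_adj (w : config G)) z y n]).
  apply: measurable_exists => // z; apply: measurable_and => //.
  exact: measurable_open_adj.
apply/seteqP; split=> w /=; rewrite walkS; first by move=> [z xz zy]; exists z.
by move=> [z [xz zy]]; exists z.
Qed.

Lemma component_refl (e : V -> V -> Prop) x : component e x x.
Proof. by exists 0%N; apply/walk0. Qed.

Lemma component_sym (w : config G) x y :
  component (open_adj w) x y -> component (open_adj w) y x.
Proof. by move=> [n xy]; exists n; apply: walk_sym xy => *; exact: open_adj_sym. Qed.

Lemma component_trans (e : V -> V -> Prop) x y z :
  component e x y -> component e y z -> component e x z.
Proof. by move=> [m xy] [n yz]; exists (m + n)%N; exact: walk_cat yz. Qed.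

Lemma component_eq (w : config G) x y : component (open_adj w) x y ->
  component (open_adj w) x = component (open_adj w) y.
Proof.
move=> xy; apply/seteqP; split=> z; last exact: component_trans.
by apply: component_trans; exact: component_sym.
Qed.

Lemma measurable_infinite_component x :
  measurable [set w : C | infinite_set (component (open_adj (w : config G)) x)].
Proof.
rewrite (_ : mkset _ = [set w : C | forall s : seq V, exists y,
    component (open_adj (w : config G)) x y /\ y \notin s]).
  apply: measurable_forall => [|s]; first exact: countable_seq.
  apply: measurable_exists => // y; apply: measurable_and.
    exact: measurable_component.
  exact: measurable_cstP.
by apply/seteqP; split=> w /=; rewrite infinite_setP.
Qed.

(** Quantifiers over sets of vertices are traded for quantifiers over vertices, which preserve
    measurability. *)
Lemma unique_infinite_clusterE : @unique_infinite_cluster V G =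
  [set w | (exists x, infinite_set (component (open_adj w) x)) /\
     forall x y, infinite_set (component (open_adj w) x) ->
       infinite_set (component (open_adj w) y) -> component (open_adj w) x y].
Proof.
apply/seteqP; split=> w /=.
  move=> [K [[[x ->] Ki] Ku]]; split; first by exists x.
  move=> u v ui vi; rewrite -(Ku (component (open_adj w) u)); last first.
    by split=> //; exists u.
  rewrite (Ku (component (open_adj w) v)); last by split=> //; exists v.
  exact: component_refl.
move=> [[x xi] H]; exists (component (open_adj w) x); split.
  by split=> //; exists x.
by move=> _ [[y ->] yi]; apply: component_eq; exact: H.
Qed.

Lemma measurable_unique_infinite_cluster :
  measurable (@unique_infinite_cluster V G : set C).
Proof.
rewrite unique_infinite_clusterE; apply: measurable_and.
  apply: measurable_exists => // x; exact: measurable_infinite_component.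
apply: measurable_forall => // x; apply: measurable_forall => // y.
do 2?[apply: measurable_imply; first exact: measurable_infinite_component].
exact: measurable_component.
Qed.

End PercolationEvents.

Section Heavy.
Variables (R : realType) (V : choiceType) (Gamma : set (V -> V)) (o : V).

(** Only finite partial sums occur, as measurability of the heavy event requires. *)
Lemma heavyP (A : set V) : heavy R Gamma o A <->
  forall n : nat, exists s : seq V, [/\ uniq s, forall x, x \in s -> A x &
    n%:R <= \sum_(x <- s) rel_weight R Gamma o x].
Proof.
rewrite /heavy /weight; split=> [H n|H].
  apply: contrapT => /forallNP Hn.
  suff : (\esum_(x in A) (rel_weight R Gamma o x)%:E <= n%:R%:E)%E by rewrite H.
  apply: ge_ereal_sup => _ [F [fF FA] <-].
  rewrite fsbig_finite//= sumEFin lee_fin leNgt; apply/negP => nF.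
  apply: (Hn (fset_set F)); split; [exact: fset_uniq| |exact: ltW].
  by move=> x; rewrite in_fset_set// in_setE => /FA.
apply/eqyP => M M0; have [s [us sA Ms]] := H (Num.bound M).
have {}sA : [set` s] `<=` A by move=> x /= /sA.
apply: esum_ge; exists [set` s]; first by split.
rewrite fsbig_finite//= sumEFin lee_fin.
have -> : \sum_(x <- fset_set [set` s]) rel_weight R Gamma o x =
    \sum_(x <- s) rel_weight R Gamma o x.
  apply: perm_big; apply: uniq_perm; [exact: fset_uniq|by []|].
  by move=> x; rewrite in_fset_set//; apply/idP/idP; rewrite in_setE.
by apply: le_trans (ltW (archi_boundP (ltW M0))) _; exact: Ms.
Qed.

End Heavy.

(** * Enumerating paths *)

Section UnionBound.
Context {d : measure_display} {T : measurableType d} {R : realType}.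
Variable mu : {measure set T -> \bar R}.

Lemma measure_union_seq (I : eqType) (l : seq I) (A : I -> T -> Prop) :
  (forall i, i \in l -> measurable [set w | A i w]) ->
  measurable [set w | exists2 i, i \in l & A i w] /\
  (mu [set w | exists2 i, i \in l & A i w] <=
     \sum_(i <- l) mu [set w | A i w])%E.
Proof.
elim: l => [_|i l IH mA].
  rewrite (_ : mkset _ = set0); last by apply/seteqP; split=> w // -[].
  by rewrite big_nil measure0; split.
have [j jl|m1 m2] := IH; first by apply: mA; rewrite inE jl orbT.
have mAi := mA i (mem_head i l).
rewrite (_ : mkset _ = [set w | A i w] `|` [set w | exists2 j, j \in l & A j w]).
  split; first exact: measurableU.
  by rewrite big_cons; apply: (le_trans (measureU2 _ _ _)) => //; rewrite leeD2l.
apply/seteqP; split=> w /=.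
  by move=> [j]; rewrite inE => /predU1P[->|jl Aj]; [left|right; exists j].
by move=> [Ai|[j jl Aj]]; [exists i; rewrite ?mem_head|exists j; rewrite ?inE ?jl ?orbT].
Qed.

End UnionBound.

Section Paths.
Variables (R : realType) (V : choiceType) (e : V -> V -> Prop).
Hypothesis e_fin : forall x, finite_set (e x).

Fixpoint paths (n : nat) (x : V) : seq (seq V) :=
  if n is m.+1 then
    flatten [seq [seq y :: t | t <- paths m y] | y <- fset_set (e x)]
  else [:: [::]].

Lemma mem_paths n x t : (t \in paths n x) =
  (size t == n) && path (fun u v => `[< e u v >]) x t.
Proof.
elim: n x t => [|n IH] x t; first by case: t => [|y t]; rewrite ?inE.
apply/flattenP/idP => [[_ /mapP[y xy ->] /mapP[t' + ->]]|].
  rewrite IH => /andP[st pt]; rewrite /= eqSS st pt andbT.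
  by rewrite -mem_nb.
case: t => // y t /=; rewrite eqSS => /andP[st /andP[xy yt]].
exists [seq y :: t' | t' <- paths n y]; first by apply: map_f; rewrite mem_nb.
by apply: map_f; rewrite IH st.
Qed.

Lemma sum_paths n (f : V -> R) x :
  \sum_(t <- paths n x) f (last x t) = iter n (nsum e) f x.
Proof.
elim: n x => [|n IH] x; first by rewrite big_seq1.
rewrite /= big_flatten/= big_map; apply: eq_bigr => y _.
by rewrite big_map -IH.
Qed.

Lemma size_paths M n x : (forall x, size (fset_set (e x)) = M) ->
  size (paths n x) = (M ^ n)%N.
Proof.
move=> eM; elim: n x => [//|n IH] x; rewrite /= size_flatten sumnE !big_map.
rewrite (eq_bigr (fun=> M ^ n)%N); last by move=> y _; rewrite size_map IH.
by rewrite big_const_seq count_predT iter_addn_0 eM expnSr.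
Qed.

Lemma walk_exit (A : V -> Prop) x z n : walk e x z n -> A x -> ~ A z ->
  exists u v, [/\ A u, ~ A v, e u v & exists m, walk e x v m].
Proof.
elim: n x => [|n IH] x; first by move=> /walk0 ->.
move=> /walkS[y xy yz] Ax Az; case: (pselect (A y)) => Ay.
  have [u [v [Au Av uv [m ym]]]] := IH _ yz Ay Az.
  by exists u, v; split=> //; exists m.+1; apply/walkS; exists y.
by exists x, y; split=> //; exists 1%N; apply/walk1.
Qed.

(* A depth-first traversal of a spanning tree, built one vertex at a time by
   inserting a detour [u, v, u]. *)
Lemma cover_walk o k : (forall x y, e x y -> e y x) ->
  finite_set (component e o) -> (k < #|` fset_set (component e o)|)%N ->
  exists t, [/\ size t = k.*2, path (fun u v => `[< e u v >]) o t,
    {subset o :: t <= fset_set (component e o)} & size (undup (o :: t)) = k.+1].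
Proof.
move=> es fK; elim: k => [|k IH] kK.
  exists [::]; split=> // x; rewrite inE => /eqP ->.
  by rewrite in_fset_set// in_setE; exists 0%N; apply/walk0.
have [t [st pt tK ut]] := IH (ltnW kK).
have [z zK zt] : exists2 z, z \in fset_set (component e o) & z \notin o :: t.
  apply: contrapT => H; move: kK; rewrite -ut ltnNge => /negP; apply.
  apply: uniq_leq_size; first exact: fset_uniq.
  move=> z zK; rewrite mem_undup; apply: contrapT => /negP zt.
  by apply: H; exists z.
have [n oz] : component e o z by move: zK; rewrite in_fset_set// in_setE.
have [] := @walk_exit (fun x => x \in o :: t) o z n oz.
- exact: mem_head.
- exact/negP.
move=> u [v [ut' vt uv ov]]; have {}vt : v \notin o :: t by exact/negP.
have vK : v \in fset_set (component e o) by rewrite in_fset_set// in_setE.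
have uK := tK _ ut'.
case/splitPl: ut' st pt tK ut vt {zt oz} => t1 t2 lu st pt tK ut vt.
exists (t1 ++ v :: u :: t2); split.
- by move: st; rewrite !size_cat /=; lia.
- move: pt; rewrite !cat_path /= lu => /andP[-> ->] /=.
  by apply/and3P; split=> //; apply/asboolP => //; exact: es.
- move=> x; rewrite inE mem_cat !inE => /or3P[xo|xt|/or3P[/eqP->|/eqP->|xt]] //.
  + by apply: tK; rewrite inE xo.
  + by apply: tK; rewrite inE mem_cat xt orbT.
  + by apply: tK; rewrite inE mem_cat xt !orbT.
have /perm_size -> : perm_eq (undup (o :: t1 ++ v :: u :: t2))
    (v :: undup (o :: t1 ++ t2)); last by rewrite /= -ut.
apply: uniq_perm; first exact: undup_uniq.
  by rewrite cons_uniq mem_undup vt undup_uniq.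
have uin : u \in o :: t1 ++ t2.
  by rewrite -lu -cat_cons mem_cat mem_last.
move=> x; rewrite mem_undup [RHS]inE mem_undup.
have [->|xu] := eqVneq x u; first by rewrite uin !inE mem_cat !inE eqxx !orbT.
rewrite !inE !mem_cat !inE (negbTE xu) /=.
by case: (x == o); case: (x == v); case: (x \in t1).
Qed.

End Paths.

Section BernoulliLists.
Variables (R : realType) (V : choiceType) (G : graph V).
Variables (p : R) (mu : probability (config_space G) R).
Hypothesis mu_bernoulli : bernoulli_law p mu.

(** Edges are listed as oriented pairs; the last hypothesis excludes listing an edge in both
    orientations, so the coordinates read are distinct. *)
Lemma bernoulli_list (l : seq (V * V)) (b : bool) :
  (forall u, u \in l -> adj G u.1 u.2) -> uniq l ->
  (forall u v, u \in l -> v \in l -> [set u.1; u.2] = [set v.1; v.2] -> u = v) ->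
  mu [set w : config G | forall u, u \in l -> open_adj w u.1 u.2 <-> b] =
  ((if b then p else 1 - p) ^+ size l)%:E.
Proof.
move=> ladj ul linj; pose t := in_tuple l.
have : forall i : 'I_(size l), exists e : edge G,
    sval e = [set (tnth t i).1; (tnth t i).2].
  by move=> i; apply: exists_edge; apply: ladj; exact: mem_tnth.
move=> /choice[f fE].
have fI : injective f.
  move=> i j fij; apply/val_inj/eqP; rewrite -(nth_uniq (tnth_default t i) (ltn_ord i) (ltn_ord j) ul).
  apply/eqP; rewrite -[l]/(val t) -!tnth_nth; apply: linj; rewrite ?mem_tnth//.
  by rewrite -!fE fij.
have := mu_bernoulli (fun=> b) fI; rewrite prodr_const card_ord => <-.
congr (mu _); apply/seteqP; split=> w /= H.
  move=> i; move: (H (tnth t i) (mem_tnth _ _)) => {H}.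
  rewrite (open_adjE _ (fE i)); case: b => [[_ ->//]|[+ _]].
  by case: (w (f i)) => // /(_ erefl).
move=> u ul'; have /tnthP[i ->] : u \in t by [].
by rewrite (open_adjE _ (fE i)) H.
Qed.

End BernoulliLists.

(** * Existence of heavy clusters *)

Lemma one_sub_expr_le_half (R : realType) (p : R) (c : nat) :
  0 <= p <= 1 -> 1 <= p * c%:R -> (1 - p) ^+ c <= 2^-1.
Proof.
move=> /andP[p0 p1] pc.
have H n : (1 - p) ^+ n * (1 + n%:R * p) <= 1.
  elim: n => [|n IH]; first by rewrite expr0 mul0r addr0 mulr1.
  apply: le_trans IH; rewrite exprSr -mulrA; apply: ler_wpM2l.
    by rewrite exprn_ge0// subr_ge0.
  rewrite -natr1; have : 0 <= n%:R :> R by []; move: (n%:R : R) => k k0; nra.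
have := H c; have : 0 <= (1 - p) ^+ c by rewrite exprn_ge0// subr_ge0.
by move: ((1 - p) ^+ c) => y y0 h; nra.
Qed.

Lemma sumr1_size (R : realType) (T : Type) (s : seq T) :
  \sum_(x <- s) (1 : R) = (size s)%:R.
Proof. by rewrite big_const_seq count_predT iter_addr_0. Qed.

Section Peierls.
Variables (R : realType) (V : choiceType) (G : graph V).
Hypothesis Vc : countable [set: V].
Variables (S : V -> V -> Prop) (M c a : nat) (beta : R).
Hypothesis S_sym : forall x y, S x y -> S y x.
Hypothesis S_adj : forall x y, S x y -> adj G x y.
Hypothesis S_fin : forall x, finite_set (S x).
Hypothesis S_deg : forall x, size (fset_set (S x)) = M.
Hypothesis S_form : form_bound S beta.
Hypothesis M_gt1 : (1 < M)%N.
Hypothesis M_ge : (c * a)%:R + beta <= M%:R.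
Hypothesis a_ge : (2 * M ^ 2 <= 2 ^ a)%N.
Variables (p : R) (mu : probability (config_space G) R).
Hypothesis p01 : 0 <= p <= 1.
Hypothesis pc : 1 <= p * c%:R.
Hypothesis mu_bernoulli : bernoulli_law p mu.
Local Notation C := (config_space G).

Let bdl (F : seq V) : seq (V * V) :=
  [seq (x, y) | x <- F, y <- [seq y <- fset_set (S x) | y \notin F]].

Let bdlP F u : (u \in bdl F) = [&& u.1 \in F, u.2 \notin F & `[< S u.1 u.2 >]].
Proof.
apply/allpairsPdep/and3P => [[x [y [xF + ->]]]|[xF yF xy]].
  by rewrite mem_filter mem_nb// => /andP[].
exists u.1, u.2; rewrite mem_filter mem_nb// yF; split=> //.
by case: u {xF yF xy}.
Qed.

Let bdl_uniq F : uniq F -> uniq (bdl F).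
Proof.
move=> uF; apply: allpairs_uniq_dep => //.
  by move=> x _; apply: filter_uniq; exact: fset_uniq.
by move=> [x y] [x' y'] _ _ /= [-> ->].
Qed.

(** At the constant function [1] on [F], [S_form] bounds the ordered [S]-pairs inside [F] by
    [beta * #|F|]; the other [S]-edges at [F] leave it. *)
Let bdl_size F : uniq F -> (c * a * size F <= size (bdl F))%N.
Proof.
move=> uF; rewrite -(ler_nat R) size_allpairs_dep sumnE big_map natr_sum.
have E x : (size [seq y <- fset_set (S x) | y \notin F])%:R =
    M%:R - \sum_(y <- F | `[< S x y >]) 1 :> R.
  rewrite -(S_deg x) -(count_predC (fun y => y \in F) (fset_set (S x))) natrD -!size_filter.
  rewrite (_ : \sum_(y <- F | _) 1 = (size [seq y <- fset_set (S x) | y \in F])%:R).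
    by rewrite addrAC subrr add0r.
  rewrite -big_filter sumr1_size; congr (_ %:R); apply: perm_size.
  apply: uniq_perm; [exact: filter_uniq|apply: filter_uniq; exact: fset_uniq|].
  by move=> y; rewrite !mem_filter mem_nb// andbC.
under eq_bigr do rewrite E.
rewrite sumrB; have := S_form uF (fun=> ler01).
rewrite (eq_bigr (fun x => \sum_(y <- F | `[< S x y >]) 1)); last first.
  by move=> x _; apply: eq_bigr => y _; rewrite mulr1.
rewrite [X in beta * X](eq_bigr (fun=> 1)); last by move=> x _; rewrite expr1n.
have -> : \sum_(x <- F) M%:R = M%:R * (size F)%:R :> R.
  by rewrite big_const_seq count_predT iter_addr_0 mulr_natr.
rewrite !sumr1_size.
rewrite natrM; have : 0 <= (size F)%:R :> R by [].
move: ((size F)%:R : R) => f f0; move: M_ge; move: (\sum_(x <- F) _) => s.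
move: ((c * a)%:R : R) (M%:R : R) => ca m h1 h2; nra.
Qed.

Let closed_bd (t : seq V) (w : config G) : Prop :=
  forall u, u \in bdl (undup t) -> open_adj w u.1 u.2 <-> false.

Let measurable_closed_bd t : measurable [set w : C | closed_bd t (w : config G)].
Proof.
rewrite (_ : mkset _ = [set w : C | forall u, u \in bdl (undup t) ->
    ~ open_adj (w : config G) u.1 u.2]).
  have Vc2 : countable [set: V * V] by rewrite -setXTT; exact: countableX.
  apply: measurable_forall => // u; apply: measurable_imply.
    exact: measurable_cstP.
  apply: measurable_not; exact: measurable_open_adj.
apply/seteqP; split=> w /= H u /H; first by move=> [+ _] => h /h.
by move=> h; split.
Qed.

(** There are at least [c * a] boundary edges per vertex. A block of [c] edges is closed with
    probability at most one half, so each vertex costs a factor [2 ^ -a], which is at most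
    [1 / (2 M^2)]. *)
Let mu_closed_bd (t : seq V) (m : nat) : size (undup t) = m.+1 ->
  (mu [set w | closed_bd t w] <= ((2 * M%:R ^+ 2) ^- m.+1)%:E)%E.
Proof.
move=> tm; have ut := undup_uniq t.
have -> := @bernoulli_list R V G p mu mu_bernoulli (bdl (undup t)) false _ (bdl_uniq ut) _.
- rewrite lee_fin; apply: le_trans (_ : (1 - p) ^+ (c * a * m.+1) <= _).
    by apply: ler_wiXn2l; move: p01 => /andP[p0 p1];
      rewrite ?subr_ge0 ?lerBlDr ?lerDl// -tm bdl_size.
  rewrite -mulnA exprM.
  apply: le_trans (_ : 2^-1 ^+ (a * m.+1) <= _).
    apply: lerXn2r; rewrite ?nnegrE ?invr_ge0//.
      by rewrite exprn_ge0// subr_ge0; case/andP: p01.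
    exact: one_sub_expr_le_half.
  rewrite exprM -exprVn; apply: lerXn2r; rewrite ?nnegrE ?exprn_ge0 ?invr_ge0 ?mulr_ge0 ?exprn_ge0//.
  rewrite exprVn lef_pV2 ?posrE ?exprn_gt0 ?mulr_gt0 ?exprn_gt0 ?ltr0n ?(ltnW M_gt1)//.
  by rewrite -!natrX -natrM ler_nat.
- by move=> u; rewrite bdlP => /and3P[_ _ /asboolP/S_adj].
- move=> [x y] [x' y']; rewrite !bdlP /= => /and3P[xt yt _] /and3P[xt' yt' _].
  move=> E; have [[-> ->]//|[xy _]] := set2_eq E.
  by move: yt'; rewrite -xy xt.
Qed.

Variables (Gamma : set (V -> V)) (o : V).
Hypothesis weight_o : rel_weight R Gamma o o = 1.
Hypothesis weight_S : forall x y, S x y -> rel_weight R Gamma o x = rel_weight R Gamma o y.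

(** A possible finite cluster with [m.+1] vertices is coded by a covering walk of [2m] steps, since
    walks are easy to count. *)
Let bad m (w : config G) : Prop := exists2 t,
  t \in [seq t <- paths S m.*2 o | size (undup (o :: t)) == m.+1] &
  closed_bd (o :: t) w.

(** At most [M^(2m)] walks, each of probability at most [(2 M^2)^-(m+1)], leave [M^-2 2^-(m+1)]; the
    sum over [m] is [M^-2 < 1]. *)
Let mu_bad m : measurable [set w : C | bad m (w : config G)] /\
  (mu [set w | bad m w] <= (M%:R ^- 2 / (2 ^ m.+1)%:R)%:E)%E.
Proof.
have [t _|mb le] := @measure_union_seq _ _ R mu _
    [seq t <- paths S m.*2 o | size (undup (o :: t)) == m.+1]
    (fun t w => closed_bd (o :: t) w).
  exact: measurable_closed_bd.
split=> //; apply: (le_trans le).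
have M0 : (0 : R) < M%:R by rewrite ltr0n ltnW.
apply: (@le_trans _ _ (\sum_(t <- [seq t <- paths S m.*2 o | size (undup (o :: t)) == m.+1])
    ((2 * M%:R ^+ 2) ^- m.+1)%:E)%E).
  rewrite big_seq [leRHS]big_seq; apply: lee_sum => t.
  by rewrite mem_filter => /andP[/eqP tm _]; exact: mu_closed_bd.
rewrite sumEFin lee_fin big_const_seq count_predT iter_addr_0 -[leLHS]mulr_natl.
apply: le_trans (_ : (M ^ m.*2)%:R * (2 * M%:R ^+ 2) ^- m.+1 <= _).
  apply: ler_wpM2r; first by rewrite invr_ge0 exprn_ge0// mulr_ge0// exprn_ge0// ltW.
  by rewrite ler_nat -(size_paths m.*2 o S_deg) size_filter count_size.
have y0 : 0 < M%:R ^+ 2 :> R by rewrite exprn_gt0.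
rewrite !natrX -mul2n exprM; move: (M%:R ^+ 2) y0 => y y0.
rewrite ler_pdivrMr; last by rewrite exprn_gt0// mulr_gt0.
rewrite [(2 * y) ^+ _]exprMn [leRHS]mulrA divfK; last by rewrite expf_neq0.
by rewrite exprS mulKf// lt0r_neq0.
Qed.

(** Only open [S]-edges are explored from [o]. Outside the bad events their component is infinite;
    it has constant weight [1] and lies in the cluster of [o], which is therefore heavy. *)
Lemma peierls : mu (has_heavy_cluster R Gamma o) <> 0%E.
Proof.
have mH : measurable (@has_heavy_cluster R V G Gamma o : set C).
  rewrite (_ : has_heavy_cluster _ _ _ = [set w : C | exists x, forall n : nat,
      exists s : seq V, (uniq s /\ forall y, y \in s -> component (open_adj (w : config G)) x y)
      /\ n%:R <= \sum_(x <- s) rel_weight R Gamma o x]).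
    apply: measurable_exists => // x; apply: measurable_forall => // n.
    apply: measurable_exists => [|s]; first exact: countable_seq.
    apply: measurable_and; last exact: measurable_cstP.
    apply: measurable_and; first exact: measurable_cstP.
    apply: measurable_forall => // y; apply: measurable_imply.
      exact: measurable_cstP.
    exact: measurable_component.
  apply/seteqP; split=> w /=.
    move=> [_ [x ->] /heavyP H]; exists x => n.
    by have [s [us sc ns]] := H n; exists s.
  move=> [x H]; exists (component (open_adj w) x); first by exists x.
  by apply/heavyP => n; have [s [[us sc] ns]] := H n; exists s.
have mB : measurable [set w : C | exists m, bad m (w : config G)].
  by apply: measurable_exists => // m; have [] := mu_bad m.
have muB : (mu [set w | exists m, bad m w] <= (M%:R ^- 2)%:E)%E.
  rewrite (_ : mkset _ = \bigcup_m [set w | bad m w]); last first.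
    by apply/seteqP; split=> w /= [m]; [exists m|exists m].
  apply: (@le_trans _ _ (\sum_(m <oo) mu [set w | bad m w])%E).
    apply: measure_sigma_subadditive => //.
      by move=> m; have [] := mu_bad m.
    by apply: bigcup_measurable => m _; have [] := mu_bad m.
  apply: (@le_trans _ _ (\sum_(m <oo) (M%:R ^- 2 / (2 ^ m.+1)%:R)%:E)%E).
    by apply: lee_nneseries => // m _; have [] := mu_bad m.
  by apply: epsilon_trick0; rewrite invr_ge0 exprn_ge0.
have sub : ~` [set w : config G | exists m, bad m w] `<=` has_heavy_cluster R Gamma o.
  move=> w /= /forallNP nb; exists (component (open_adj w) o); first by exists o.
  pose E x y := S x y /\ open_adj w x y.
  have Es x y : E x y -> E y x by move=> [/S_sym ? /open_adj_sym].
  have KE : infinite_set (component E o).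
    move=> fK; have K0 : (0 < #|` fset_set (component E o)|)%N.
      rewrite cardfs_gt0; apply/fset0Pn; exists o.
      by rewrite in_fset_set// in_setE; exists 0%N; apply/walk0.
    set K := fset_set (component E o) in K0.
    have [|t [st pt tK ut]] := @cover_walk V E o #|`K|.-1 Es fK; first by rewrite prednK.
    apply: (nb #|`K|.-1); exists t.
      rewrite mem_filter ut eqxx mem_paths// st eqxx /=.
      by apply: sub_path pt => x y /asboolP[xy _]; apply/asboolP.
    (* A repetition-free list inside [K] of the same size is all of [K], so the walk has exactly the
       boundary of the cluster. *)
    have tKE : undup (o :: t) =i K.
      have [||_ tKE] := @uniq_min_size _ (undup (o :: t)) K (undup_uniq _).
      - by move=> x; rewrite mem_undup => /tK.
      - by rewrite ut prednK.
      exact: tKE.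
    move=> [x y]; rewrite bdlP !tKE /= => /and3P[xK yK /asboolP xy]; split=> // oxy.
    case/negP: yK; move: xK; rewrite !in_fset_set// !in_setE => -[n ox].
    by exists n.+1; apply/walkSr; exists x.
  apply/heavyP => n; have [X XK nX] := infinite_set_fset n KE.
  have XE x : x \in X -> component E o x by move=> /XK.
  exists X; split; first exact: fset_uniq.
    by move=> x /XE[k ox]; exists k; apply: walk_sub ox => ? ? [].
  rewrite (eq_big_seq (fun=> 1)); last first.
    move=> x /XE[k]; elim: k x => [|k IH] x; first by move=> /walk0 <-.
    by move=> /walkSr[y /IH <- [/weight_S ->]].
  by rewrite sumr1_size ler_nat.
move=> H0; have : (mu (~` [set w | exists m, bad m w]) <= 0)%E.
  by rewrite -H0; apply: le_measure => //; rewrite inE//; exact: measurableC.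
rewrite probability_setC// leNgt => /negP; apply.
rewrite sube_gt0; apply: (le_lt_trans muB); rewrite lte_fin.
rewrite invf_lt1 ?exprn_gt0 ?ltr0n ?(ltnW M_gt1)//.
by rewrite exprn_egt1// ltr1n.
Qed.

End Peierls.

(** * Non-uniqueness *)

Section SecondMoment.
Context {d : measure_display} {T : measurableType d} {R : realType}.
Variable P : probability T R.
Local Notation pr A := (fine (P A)).

Lemma pr_split A B : measurable A -> measurable B ->
  pr B = pr (B `&` A) + pr (B `\` A).
Proof.
move=> mA mB; rewrite -fineD ?fin_num_measure//.
- by congr fine; rewrite addeC -measureDI.
- exact: measurableI.
- exact: measurableD.
Qed.

(* The expectation of [(X - a) ^+ 2 * 1_B], where [X] is the number of events
   [A i] that occur, is nonnegative; conditioning on the events one by one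
   avoids integrals. *)
Lemma second_moment (I : Type) (A : I -> set T) (l : seq I) (B : set T) (a : R) :
  (forall i, measurable (A i)) -> measurable B ->
  0 <= \sum_(i <- l) \sum_(j <- l) pr (B `&` A i `&` A j)
       - 2 * a * (\sum_(i <- l) pr (B `&` A i)) + a ^+ 2 * pr B.
Proof.
move=> mA; elim: l B a => [|k l IH] B a mB.
  by rewrite !big_nil mulr0 subr0 add0r mulr_ge0 ?sqr_ge0 ?fine_ge0.
have mB1 : measurable (B `&` A k) by exact: measurableI.
have mB2 : measurable (B `\` A k) by exact: measurableD.
have := IH (B `&` A k) (a - 1) mB1; have := IH (B `\` A k) a mB2.
have eD (X Y Z : set T) : (X `&` Y) `\` Z = (X `\` Z) `&` Y.
  by rewrite !setDE setIAC.
have S1 : \sum_(i <- l) pr (B `&` A i) = \sum_(i <- l) pr (B `&` A k `&` A i) +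
    \sum_(i <- l) pr ((B `\` A k) `&` A i).
  rewrite -big_split/=; apply: eq_bigr => i _.
  rewrite (pr_split (mA k)); last exact: measurableI.
  by rewrite setIAC eD.
have S2 : \sum_(i <- l) \sum_(j <- l) pr (B `&` A i `&` A j) =
    \sum_(i <- l) \sum_(j <- l) pr (B `&` A k `&` A i `&` A j) +
    \sum_(i <- l) \sum_(j <- l) pr ((B `\` A k) `&` A i `&` A j).
  rewrite -big_split/=; apply: eq_bigr => i _.
  rewrite -big_split/=; apply: eq_bigr => j _.
  rewrite (pr_split (mA k)); last by do 2?apply: measurableI.
  by rewrite (setIAC (B `&` A i)) (setIAC B (A i) (A k)) !eD.
have S3 : \sum_(i <- l) \sum_(j <- k :: l) pr (B `&` A i `&` A j) =
    \sum_(i <- l) pr (B `&` A k `&` A i) +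
    \sum_(i <- l) \sum_(j <- l) pr (B `&` A i `&` A j).
  rewrite -big_split/=; apply: eq_bigr => i _.
  by rewrite big_cons [B `&` A i `&` A k]setIAC.
rewrite big_cons S3.
rewrite !big_cons S1 S2 -setIA setIid (pr_split (mA k) mB).
lra.
Qed.

End SecondMoment.

(** * Invariance of the Bernoulli law under relabelling of edges *)

Section BernoulliUnique.
Variables (R : realType) (V : choiceType) (G : graph V) (p : R).
Variable mu : probability (config_space G) R.
Hypothesis mu_bernoulli : bernoulli_law p mu.
Local Notation C := (config_space G).

Let cyl n (e : 'I_n -> edge G) (b : 'I_n -> bool) : set (config G) :=
  [set w | forall i, w (e i) = b i].

Let measurable_cyl n e b : measurable (@cyl n e b : set C).
Proof.
apply: measurable_forall => [|i]; first exact: countableP.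
by apply: sub_sigma_algebra; exists (e i), (b i).
Qed.

Let cyl_map n e b (h : edge G -> edge G) : injective h ->
  mu (@cyl n (h \o e) b) = mu (cyl e b).
Proof.
move=> hI; elim: n e b => [|n IH] e b.
  by congr (mu _); apply/seteqP; split=> w _ [].
case: (pselect (injective e)) => [eI|].
  rewrite (mu_bernoulli b eI) (mu_bernoulli b (_ : injective (h \o e)))//.
  exact: inj_comp.
move=> /existsNP[i /existsNP[j /not_implyP[eij /eqP ij]]].
have [bij|bij] := eqVneq (b i) (b j); last first.
  have E0 (f : 'I_n.+1 -> edge G) : f i = f j -> cyl f b = set0.
    move=> fij; apply/seteqP; split=> w // H.
    by case/negP: bij; rewrite -(H i) -(H j) fij.
  by rewrite (E0 e eij) (E0 (h \o e) (congr1 h eij)).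
have red (f : 'I_n.+1 -> edge G) : f i = f j ->
    cyl f b = cyl (f \o lift i) (b \o lift i).
  move=> fij; apply/seteqP; split=> w /= H k; first exact: H.
  have [<-|/unlift_some[k' -> _]] := eqVneq i k; last exact: H.
  have [j' jE _] := unlift_some ij.
  by rewrite fij bij jE; exact: H.
rewrite (red e eij) (red (h \o e) (congr1 h eij)); exact: IH.
Qed.

Lemma bernoulli_map (h : edge G -> edge G) : injective h ->
  forall A : set C, measurable A -> mu [set w : config G | A (w \o h)] = mu A.
Proof.
move=> hI.
have mh : measurable_fun setT (fun w : C => (w \o h : C)).
  apply: (@measurability _ _ C C setT _ (@cylinders V G)) => //.
  move=> _ [_ [e [b ->]] <-]; rewrite setTI.
  by apply: sub_sigma_algebra; exists (h e), b.
move=> A mA; rewrite -[LHS]/(pushforward mu (fun w : C => (w \o h : C)) A).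
(* Repeated edges are allowed here, so concatenating two families shows closure under
   intersection. *)
pose GG : set (set C) := [set X | exists n (e : 'I_n -> edge G) b, X = cyl e b].
apply: (@measure_unique _ R C GG (fun=> setT)) => //.
- apply/seteqP; split.
    apply: smallest_sub; first exact: smallest_sigma_algebra.
    move=> _ [e [b ->]]; apply: sub_sigma_algebra.
    exists 1%N, (fun=> e), (fun=> b); by apply/seteqP; split=> w /= => [wb _|/(_ ord0)].
  apply: smallest_sub; first exact: sigma_algebra_measurable.
  by move=> _ [n [e [b ->]]]; exact: measurable_cyl.
- move=> _ _ [n [e [b ->]]] [n' [e' [b' ->]]].
  pose join (T : Type) (u : 'I_n -> T) (v : 'I_n' -> T) (k : 'I_(n + n')) :=
    match fintype.split k with inl i => u i | inr j => v j end.
  exists (n + n')%N, (join _ e e'), (join _ b b').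
  apply/seteqP; split=> w /=; rewrite /join.
    by move=> [H H'] k; case: fintype.split.
  move=> H; split=> i.
    by have := H (lshift n' i); rewrite (unsplitK (inl i)).
  by have := H (rshift n i); rewrite (unsplitK (inr i)).
- by move=> _; exists 0%N, (fun i : 'I_0 => match i with Ordinal _ h0 => False_rect _ (notF h0) end),
    (fun=> true); apply/seteqP; split=> w // _ [].
- by rewrite bigcup_const//; exists 0%N.
- by move=> _ [n [e [b ->]]]; exact: (cyl_map e b hI).
- move=> _; apply: (@le_lt_trans _ _ 1%E); last by rewrite ltry.
  by rewrite -[X in (X <= _)%E]/(mu setT); exact: probability_le1.
Qed.

End BernoulliUnique.

(** * Connectivity sums below the inverse norm *)

Section NonUniqueness.
Variables (R : realType) (V : choiceType) (G : graph V).
Hypothesis Vc : countable [set: V].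
Hypothesis G_fin : locally_finite G.
Variables (p B : R) (mu : probability (config_space G) R).
Hypothesis B_gt0 : 0 < B.
Hypothesis G_form : form_bound (adj G) B.
Hypothesis p_ge0 : 0 <= p.
Hypothesis pB : p * B < 1.
Hypothesis mu_bernoulli : bernoulli_law p mu.
Local Notation C := (config_space G).
Local Notation conn x y := [set w : config G | component (open_adj w) x y].

Let measurable_conn x y : measurable (conn x y : set C).
Proof. exact: measurable_component. Qed.

(** [zip (x :: t) t] lists the consecutive pairs. The path is self-avoiding so that its edges are
    distinct and it is open with probability [p ^+ n]. *)
Let open_path n x y (w : config G) : Prop := exists2 t,
  t \in [seq t <- paths (adj G) n x | (last x t == y) && uniq (x :: t)] &
  forall u, u \in zip (x :: t) t -> open_adj w u.1 u.2 <-> true.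

Let zip_pathP (r : V -> V -> Prop) x t : path (fun u v => `[< r u v >]) x t ->
  forall u, u \in zip (x :: t) t -> r u.1 u.2.
Proof.
elim: t x => [|y t IH] x //= /andP[/asboolP xy yt] u.
by rewrite inE => /predU1P[->//|]; exact: IH.
Qed.

Let zip_mem (x : V) (t : seq V) u : u \in zip (x :: t) t -> (u.1 \in x :: t) && (u.2 \in t).
Proof.
elim: t x => [|y t IH] x //=; rewrite inE => /predU1P[->|/IH/andP[u1 u2]].
  by rewrite /= !mem_head.
by rewrite inE u1 orbT inE u2 orbT.
Qed.

Let zip_uniq (x : V) (t : seq V) : uniq (x :: t) -> uniq (zip (x :: t) t).
Proof.
elim: t x => [|y t IH] x //= /andP[xt yt]; rewrite IH// andbT.
by apply/negP => /zip_mem/andP[/= + _]; apply/negP.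
Qed.

Let zip_inj (x : V) (t : seq V) u v : uniq (x :: t) -> u \in zip (x :: t) t ->
  v \in zip (x :: t) t -> [set u.1; u.2] = [set v.1; v.2] -> u = v.
Proof.
elim: t x => [|y t IH] x //= /andP[xt yt].
have hd z : z \in zip (y :: t) t -> [set x; y] = [set z.1; z.2] -> False.
  move=> /zip_mem/andP[z1 z2] E; have [[xz _]|[xz _]] := set2_eq E.
    by move: xt; rewrite xz z1.
  by move: xt; rewrite xz inE z2 orbT.
rewrite !inE => /predU1P[->|uz] /predU1P[->|vz] E //.
- by case: (hd v vz).
- by case: (hd u uz).
exact: IH yt uz vz E.
Qed.

Let size_zip_path (x : V) t : size (zip (x :: t) t) = size t.
Proof. by rewrite size_zip /=; apply/minn_idPr. Qed.

Let mu_open_path n x y : measurable [set w : C | open_path n x y (w : config G)] /\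
  (mu [set w | open_path n x y w] <= (p ^+ n * (cnt (adj G) n x y)%:R)%:E)%E.
Proof.
have [t tP|mO le] := @measure_union_seq _ _ R mu _
    [seq t <- paths (adj G) n x | (last x t == y) && uniq (x :: t)]
    (fun t w => forall u, u \in zip (x :: t) t -> open_adj w u.1 u.2 <-> true).
  have Vc2 : countable [set: V * V] by rewrite -setXTT; exact: countableX.
  apply: measurable_forall => // u; apply: measurable_imply.
    exact: measurable_cstP.
  rewrite (_ : mkset _ = [set w : C | open_adj (w : config G) u.1 u.2]).
    exact: measurable_open_adj.
  by apply/seteqP; split=> w /=; [case=> _; exact|].
split=> //; apply: (le_trans le); rewrite cntE// -sum_paths mulr_sumr -sumEFin.
rewrite big_filter big_mkcond /= big_seq [leRHS]big_seq; apply: lee_sum => t.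
rewrite mem_paths// => /andP[/eqP st pt]; case: ifP => [/andP[-> ut]|_]; last first.
  by rewrite lee_fin mulr_ge0// exprn_ge0.
rewrite (@bernoulli_list R V G p mu mu_bernoulli (zip (x :: t) t) true) ?size_zip_path ?st ?mulr1//.
- exact: zip_pathP.
- exact: zip_uniq.
- by move=> u v; exact: zip_inj.
Qed.

Let conn_open_path x y : conn x y `<=` \bigcup_n [set w | open_path n x y w].
Proof.
move=> w /= [n xy].
have [t pt yl] : exists2 t, path (fun u v => `[< open_adj w u v >]) x t & last x t = y.
  elim: n x xy => [|n IH] x; first by move=> /walk0 ->; exists [::].
  move=> /walkS[z /asboolP xz /IH[t pt lt]]; exists (z :: t) => //=.
  by rewrite xz.
move: yl; case/shortenP: pt => t' pt' ut' _ yl; exists (size t') => //.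
exists t'; last by move=> u /(zip_pathP pt') ?; split.
rewrite mem_filter yl eqxx ut' mem_paths// eqxx /=.
by apply: sub_path pt' => u v /asboolP/open_adj_adj uv; apply/asboolP.
Qed.

Let mu_conn x y :
  (mu (conn x y) <= \sum_(n <oo) (p ^+ n * (cnt (adj G) n x y)%:R)%:E)%E.
Proof.
apply: (@le_trans _ _ (\sum_(n <oo) mu [set w | open_path n x y w])%E).
  apply: measure_sigma_subadditive.
  - by move=> n; have [] := mu_open_path n x y.
  - exact: measurable_conn.
  - exact: conn_open_path.
apply: lee_nneseries => [//|n _]; by have [] := mu_open_path n x y.
Qed.

(** The walks of length [n] contribute at most [(p * B) ^+ n * size l], by [pow_form] at the
    constant function [1]; the bound is the geometric series. *)
Lemma sum_connectivity (l : seq V) : uniq l ->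
  \sum_(x <- l) \sum_(y <- l) fine (mu (conn x y)) <= (size l)%:R / (1 - p * B).
Proof.
move=> ul; rewrite -lee_fin -sumEFin.
have cge0 x y n : 0 <= p ^+ n * (cnt (adj G) n x y)%:R by rewrite mulr_ge0// exprn_ge0.
apply: (@le_trans _ _ (\sum_(x <- l) \sum_(y <- l)
    \sum_(n <oo) (p ^+ n * (cnt (adj G) n x y)%:R)%:E)%E).
  apply: lee_sum => x _; rewrite -sumEFin; apply: lee_sum => y _.
  by rewrite fineK ?fin_num_measure//; exact: mu_conn.
apply: (@le_trans _ _ (\sum_(n <oo) (\sum_(x <- l) \sum_(y <- l)
    (p ^+ n * (cnt (adj G) n x y)%:R))%:E)%E).
  rewrite le_eqVlt; apply/orP; left; apply/eqP; apply/esym.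
  under eq_eseriesr do rewrite -sumEFin.
  rewrite nneseries_sum//; last by move=> x n _; rewrite lee_fin sumr_ge0.
  apply: eq_bigr => x _; under eq_eseriesr do rewrite -sumEFin.
  by rewrite nneseries_sum// => y n _; rewrite lee_fin.
apply: lime_le; first by apply: is_cvg_nneseries => n _ _; rewrite lee_fin sumr_ge0// => x _; rewrite sumr_ge0.
apply: nearW => N; rewrite sumEFin lee_fin.
have q0 : 0 <= p * B by rewrite mulr_ge0// ltW.
apply: (@le_trans _ _ (\sum_(0 <= n < N) (p * B) ^+ n * (size l)%:R)).
  apply: ler_sum => n _; have := pow_form (adj_sym (g := G)) G_fin n B_gt0 G_form ul (fun=> ler01).
  rewrite [X in B ^+ n * X](eq_bigr (fun=> 1)); last by move=> x _; rewrite expr1n.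
  rewrite sumr1_size => h; rewrite exprMn -mulrA.
  apply: le_trans (ler_wpM2l (exprn_ge0 n p_ge0) h).
  rewrite mulr_sumr; apply: ler_sum => x _; rewrite mulr_sumr; apply: ler_sum => y _.
  by rewrite !mul1r.
rewrite -mulr_suml mulrC ler_wpM2l// -[leRHS]mul1r ler_pdivlMr ?subr_gt0//.
rewrite mulrC big_mkord; have := subrX1 (p * B) N => h.
have := exprn_ge0 N q0; rewrite -opprB mulNr -h; lra.
Qed.

Hypothesis V_inf : infinite_set [set: V].
Hypothesis G_tr : forall x y : V, exists g h : V -> V,
  [/\ cancel g h, cancel h g, g x = y & forall u v, adj G (g u) (g v) <-> adj G u v].
Local Notation inf x := [set w : config G | infinite_set (component (open_adj w) x)].

Let measurable_inf x : measurable (inf x : set C).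
Proof. exact: measurable_infinite_component. Qed.

Let mu_inf x y : mu (inf x) = mu (inf y).
Proof.
have [g [h [gh hg gx gG]]] := G_tr x y.
have : forall e : edge G, exists e' : edge G, sval e' = g @` sval e.
  move=> [e He]; have [u [v [uv E0]]] := He.
  have [e' e'E] := exists_edge (iffRL (gG u v) uv).
  by exists e'; rewrite e'E /= E0 image_setU !image_set1.
move=> /choice[f fE].
have fI : injective f.
  move=> e e' ee'; apply: eq_sig_hprop; first by move=> *; exact: Prop_irrelevance.
  have : g @` sval e = g @` sval e' by rewrite -!fE ee'.
  move=> E; apply/seteqP; split=> z ez.
    have : (g @` sval e') (g z) by rewrite -E; exists z.
    by move=> [z' + /(can_inj gh) <-].
  have : (g @` sval e) (g z) by rewrite E; exists z.
  by move=> [z' + /(can_inj gh) <-].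
have openE w u v : open_adj (w \o f) u v <-> open_adj w (g u) (g v).
  split=> [[e we euv]|guv].
    by exists (f e) => //; rewrite fE euv image_setU !image_set1.
  have [e euv] := exists_edge (iffLR (gG u v) (open_adj_adj guv)).
  have fe : sval (f e) = [set g u; g v] by rewrite fE euv image_setU !image_set1.
  by exists e => //; apply/(open_adjE _ fe).
rewrite -(bernoulli_map mu_bernoulli fI (measurable_inf x)).
congr (mu _); apply/seteqP; split=> w /= H fin; apply: H.
  apply: (@sub_finite_set _ _ (h @` component (open_adj w) y)); last exact: (finite_image _ fin).
  move=> z [n xz]; exists (g z) => //; exists n; rewrite -gx.
  elim: n x xz {gx fin} => [|n IH] x; first by move=> /walk0 ->; apply/walk0.
  by move=> /walkS[u /openE xu /IH uz]; apply/walkS; exists (g u).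
apply: (@sub_finite_set _ _ (g @` component (open_adj (w \o f)) x)); last exact: (finite_image _ fin).
move=> z [n yz]; exists (h z) => //; exists n.
have {gx} <- : h y = x by rewrite -gx gh.
elim: n y yz {fin} => [|n IH] y; first by move=> /walk0 ->; apply/walk0.
move=> /walkS[u yu /IH uz]; apply/walkS; exists (h u) => //.
by apply/openE; rewrite !hg.
Qed.

(** No correlation inequality is used: [second_moment] shows that [mu (inf x & inf y)] averages at
    least [th ^+ 2] over pairs from [X]. Under uniqueness this is a connection probability, so
    [sum_connectivity] bounds [size X * th ^+ 2] independently of [X]. *)
Lemma not_unique : mu (@unique_infinite_cluster V G) <> 1%E.
Proof.
move=> mu1; have mU := @measurable_unique_infinite_cluster V G Vc.
have muC : mu (~` (@unique_infinite_cluster V G)) = 0%E.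
  by rewrite probability_setC// mu1 subee.
have [x0 _] : exists x : V, True.
  apply: contrapT => /forallNP H; apply: V_inf.
  rewrite (_ : [set: V] = set0)//; apply/seteqP; split=> x // _.
  exact: (H x).
set th := fine (mu (inf x0)).
have thE x : mu (inf x) = th%:E.
  by rewrite (mu_inf x x0) /th fineK// fin_num_measure.
(* Otherwise the existence of an infinite cluster is a countable union of null events. *)
have th0 : 0 < th.
  rewrite lt_neqAle fine_ge0// andbT; apply/eqP => th0.
  have /countable_injP[f fI] := Vc.
  pose A n : set (config G) := [set w | exists x, f x = n /\ inf x w].
  have A0 n : measurable (A n : set C) /\ mu (A n) = 0%E.
    case: (pselect (exists x, f x = n)) => [[x xn]|nx].
      suff -> : A n = inf x by rewrite thE -th0.
      apply/seteqP; split=> w; last by exists x.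
      by move=> [y [yn]]; suff -> : x = y by []; apply: fI; rewrite ?inE// xn yn.
    suff -> : A n = set0 by rewrite measure0.
    by apply/seteqP; split=> w // -[x [xn _]]; apply: nx; exists x.
  have : (mu (@unique_infinite_cluster V G) <= \sum_(n <oo) mu (A n))%E.
    apply: measure_sigma_subadditive => //; first by move=> n; have [] := A0 n.
    rewrite unique_infinite_clusterE => w [[x xi] _].
    by exists (f x) => //; exists x.
  rewrite mu1 eseries0; last by move=> n _ _; have [] := A0 n.
  by rewrite lee_fin ler10.
have pair x y : fine (mu (inf x `&` inf y)) <= fine (mu (conn x y)).
  have mI : measurable (inf x `&` inf y : set C) by exact: measurableI.
  rewrite fine_le ?fin_num_measure//.
  rewrite (measureDI _ mI mU) [X in (X + _ <= _)%E](_ : _ = 0%E); last first.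
    apply/eqP; rewrite -measure_le0 -muC; apply: le_measure; rewrite ?inE//.
    - exact: measurableD.
    - exact: measurableC.
  rewrite add0e; apply: le_measure; rewrite ?inE//; first exact: measurableI.
  rewrite unique_infinite_clusterE => w [[xi yi] [_ H]]; exact: H.
have bound m : m%:R * th ^+ 2 <= (1 - p * B)^-1.
  case: m => [|m]; first by rewrite mul0r invr_ge0 subr_ge0 ltW.
  have [X _ mX] := infinite_set_fset m.+1 V_inf.
  have X0 : (0 : R) < (size X)%:R by rewrite ltr0n; apply: leq_trans mX.
  (* The value of [a] is the mean number of vertices of [X] in infinite clusters, so the expression
     is the variance. *)
  have := @second_moment _ C R mu V (fun x => inf x) X setT ((size X)%:R * th)
    measurable_inf measurableT.
  rewrite probability_setT /= mulr1.
  rewrite [X in _ - _ * X + _](eq_bigr (fun=> th * 1)); last first.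
    by move=> x _; rewrite setTI thE mulr1.
  rewrite -mulr_sumr sumr1_size.
  have : \sum_(x <- X) \sum_(y <- X) fine (mu (setT `&` inf x `&` inf y)) <=
      (size X)%:R / (1 - p * B).
    apply: le_trans (sum_connectivity (fset_uniq X)).
    by apply: ler_sum => x _; apply: ler_sum => y _; rewrite setTI; exact: pair.
  have : (m.+1)%:R <= (size X)%:R :> R by rewrite ler_nat.
  move: (\sum_(x <- X) _) (1 - p * B)^-1 (m.+1%:R : R) => s i k.
  move: ((size X)%:R : R) X0 => z z0 h1 h2 h3.
  have : z * (z * th ^+ 2) <= z * i by nra.
  rewrite ler_pM2l// => h4; apply: le_trans h4.
  by apply: ler_wpM2r => //; exact: sqr_ge0.
have t2 : 0 < th ^+ 2 by rewrite exprn_gt0.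
have := bound (Num.bound ((1 - p * B)^-1 / th ^+ 2)); apply/negP; rewrite -ltNge.
rewrite -ltr_pdivrMr//; apply: archi_boundP; apply: divr_ge0; last exact: ltW.
by rewrite invr_ge0 subr_ge0 ltW.
Qed.

End NonUniqueness.

(** * The level graph *)

(** Bernoulli's inequality for the square root of [s], squared, gives quadratic growth. *)
Lemma exp_ge_linear (R : realType) (s C : R) : 1 < s ->
  exists n0, forall n, (n0 <= n)%N -> C * n.+1%:R <= s ^+ n.
Proof.
move=> s1; set u := Num.sqrt s.
have s0 : 0 <= s by rewrite ltW// (lt_trans ltr01).
have u1 : 1 < u by rewrite -sqrtr1 ltr_sqrt// (lt_trans ltr01).
have bern n : 1 + n%:R * (u - 1) <= u ^+ n.
  elim: n => [|n IH]; first by rewrite mul0r addr0 expr0.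
  rewrite exprS; apply: le_trans (ler_wpM2l (ltW (lt_trans ltr01 u1)) IH).
  rewrite -natr1; have := mulr_ge0 (ler0n R n) (sqr_ge0 (u - 1)); lra.
have e0 : 0 < (u - 1) ^+ 2 by rewrite exprn_gt0// subr_gt0.
exists (Num.bound (2 * `|C| / (u - 1) ^+ 2)).+1 => n nn.
have h : 2 * `|C| <= n%:R * (u - 1) ^+ 2.
  have x0 : 0 <= 2 * `|C| / (u - 1) ^+ 2 by apply: divr_ge0; [exact: mulr_ge0|exact: sqr_ge0].
  rewrite -ler_pdivrMr//; apply: ltW; apply: (lt_le_trans (archi_boundP x0)).
  by rewrite ler_nat ltnW.
have n1 : 1 <= n%:R :> R by rewrite ler1n (leq_trans _ nn).
apply: le_trans (_ : `|C| * n.+1%:R <= _); first by rewrite ler_wpM2r// ler_norm.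
have -> : s ^+ n = u ^+ n ^+ 2 by rewrite exprAC sqr_sqrtr.
apply: le_trans (_ : (n%:R * (u - 1)) ^+ 2 <= _); last first.
  apply: lerXn2r; rewrite ?nnegrE ?exprn_ge0 ?sqrtr_ge0 ?mulr_ge0 ?subr_ge0 ?(ltW u1)//.
  by apply: le_trans (bern n); rewrite lerDr.
rewrite -natr1; have := normr_ge0 C.
move: h n1; move: (`|C|) (n%:R : R) (u - 1) => c k v h n1 c0.
rewrite exprMn expr2 -mulrA; nra.
Qed.

Lemma exp_ge_poly (R : realType) (s C : R) (k : nat) : 1 < s ->
  exists n0, forall n, (n0 <= n)%N -> C * n.+1%:R ^+ k <= s ^+ n.
Proof.
elim: k s => [|k IH] s s1.
  have [n0 H] := exp_ge_linear `|C| s1; exists n0 => n /H; apply: le_trans.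
  rewrite expr0 mulr1; apply: (le_trans (ler_norm C)).
  by rewrite ler_peMr// ler1n.
set u := Num.sqrt s.
have s0 : 0 <= s by rewrite ltW// (lt_trans ltr01).
have u1 : 1 < u by rewrite -sqrtr1 ltr_sqrt// (lt_trans ltr01).
have [n1 H1] := IH _ u1; have [n2 H2] := exp_ge_linear 1 u1.
exists (maxn n1 n2) => n; rewrite geq_max => /andP[/H1 h1 /H2]; rewrite mul1r => h2.
have -> : s ^+ n = u ^+ n * u ^+ n by rewrite -exprMn -expr2 sqr_sqrtr.
rewrite exprSr mulrA; apply: le_trans (ler_wpM2r _ h1) _ => //.
by apply: ler_wpM2l => //; rewrite exprn_ge0// sqrtr_ge0.
Qed.

Lemma quasi_isometric_refine (R : realType) (V : Type) (G H : graph V) (k : nat) :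
  connected_graph G -> (0 < k)%N ->
  (forall x y, adj G x y -> adj H x y) ->
  (forall x y, adj H x y -> exists2 n, (n <= k)%N & walk (adj G) x y n) ->
  quasi_isometric R G H.
Proof.
move=> cG k0 GH HG; exists id, k%:R, 0.
have k1 : 1 <= k%:R :> R by rewrite ler1n.
have kp : 0 < k%:R :> R by rewrite ltr0n.
have dist0 (K : graph V) x y : has_lbound [set (n%:R : R) | n in walk (adj K) x y].
  by exists 0 => _ [n _ <-].
have GHw x y n : walk (adj G) x y n -> walk (adj H) x y n by exact: walk_sub.
have HGw x y n : walk (adj H) x y n ->
    exists2 m, (m <= k * n)%N & walk (adj G) x y m.
  elim: n x => [|n IH] x; first by move=> /walk0 ->; exists 0%N; [|apply/walk0].
  move=> /walkS[z /HG[i ik xz] /IH[j jn zy]]; exists (i + j)%N.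
    by rewrite mulnS leq_add.
  exact: walk_cat zy.
have distG x y : 0 <= graph_dist R G x y.
  have [n xy] := cG x y.
  by apply: lb_le_inf; [exists n%:R, n|move=> _ [m _ <-]].
have distHG x y : graph_dist R H x y <= graph_dist R G x y.
  have [n xy] := cG x y; apply: lb_le_inf; first by exists n%:R, n.
  by move=> _ [m /GHw xym <-]; apply: ge_inf => //; exists m.
split=> //.
- move=> x y; rewrite subr0 addr0; apply/andP; split; last first.
    by apply: (le_trans (distHG x y)); rewrite ler_peMl.
  have [n xy] := cG x y; apply: lb_le_inf; first by exists n%:R, n => //; exact: GHw.
  move=> _ [m /HGw[i im xyi] <-]; rewrite mulrC ler_pdivrMr//.
  apply: le_trans (_ : i%:R <= _); first by apply: ge_inf => //; exists i.
  by rewrite -natrM ler_nat mulnC.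
- move=> z; exists z; apply: le_trans (distHG z z) _.
  by apply: ge_inf => //; exists 0%N => //; apply/walk0.
Qed.

Lemma form_bound_le (R : realType) (V : choiceType) (e : V -> V -> Prop) (B B' : R) :
  B <= B' -> form_bound e B -> form_bound e B'.
Proof.
move=> BB' eB s f us f0; apply: (le_trans (eB s f us f0)).
by apply: ler_wpM2r => //; apply: sumr_ge0 => x _; rewrite sqr_ge0.
Qed.

(** * Consequences of w-nonamenability *)

Section Nonamenable.
Variables (R : realType) (V : choiceType) (G : graph V) (Gamma : set (V -> V)) (o : V).
Hypothesis orbit_fin : forall x y, finite_set (stab_orbit Gamma x y).
Hypothesis Gamma_id : Gamma id.
Hypothesis G_fin : locally_finite G.
Hypothesis G_nonamenable : weight_nonamenable R G Gamma o.
Local Notation W := (rel_weight R Gamma).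

Let weight_finite (F : set V) : finite_set F ->
  weight R Gamma o F = (\sum_(x <- fset_set F) W o x)%:E.
Proof.
move=> fF; rewrite /weight esum_fset//; last first.
  by move=> x _; rewrite lee_fin ltW// weight_gt0.
by rewrite fsbig_finite//= sumEFin.
Qed.

Let bd_fin (F : set V) : finite_set F -> finite_set (vertex_boundary G F).
Proof.
move=> fF; apply: (@sub_finite_set _ _ (\bigcup_(x in F) adj G x)).
  by move=> y [_ [x Fx xy]]; exists x.
by apply: bigcup_finite => // x _; exact: G_fin.
Qed.

Lemma weight_expand : exists2 c : R, 0 < c & forall F : seq V, uniq F -> F != [::] ->
  c * \sum_(x <- F) W o x <=
  \sum_(y <- fset_set [set y | y \notin F /\ exists2 x, x \in F & adj G x y]) W o y.
Proof.
have [c c0 cI] : exists2 c : R, 0 < c & (c%:E <= ereal_inf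
    [set weight R Gamma o (vertex_boundary G F) / weight R Gamma o F
    | F in [set F : set V | finite_set F /\ F !=set0]])%E.
  move: G_nonamenable; rewrite /weight_nonamenable.
  case: (ereal_inf _) => [r|_|//]; first by rewrite lte_fin => r0; exists r.
  by exists 1 => //; rewrite leey.
exists c => // F uF F0.
have FE : [set y | y \notin F /\ exists2 x, x \in F & adj G x y] =
    vertex_boundary G [set` F].
  by apply/seteqP; split=> y [/negP yF [x xF xy]]; split=> //; exists x.
rewrite FE; have fF : finite_set [set` F] by exact: finite_seq.
have sF : \sum_(x <- fset_set [set` F]) W o x = \sum_(x <- F) W o x.
  apply: perm_big; apply: uniq_perm; [exact: fset_uniq|by []|].
  by move=> x; rewrite in_fset_set//; apply/idP/idP; rewrite in_setE.
have s0 : 0 < \sum_(x <- F) W o x.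
  case: (F) F0 => // x l _; rewrite big_cons ltr_pwDl ?weight_gt0//.
  by apply: sumr_ge0 => y _; rewrite ltW// weight_gt0.
have /ereal_inf_lbound/(le_trans cI) : [set weight R Gamma o (vertex_boundary G F) / weight R Gamma o F
    | F in [set F : set V | finite_set F /\ F !=set0]]%E
    (weight R Gamma o (vertex_boundary G [set` F]) / weight R Gamma o [set` F])%E.
  exists [set` F] => //; split=> //.
  by case: (F) F0 => // x l _; exists x; rewrite /= mem_head.
rewrite !weight_finite//; last exact: bd_fin.
by rewrite sF inver gt_eqF// -EFinM lee_fin ler_pdivlMr.
Qed.

(** A finite vertex set would have positive weight and empty boundary. *)
Lemma nonamenable_infinite : infinite_set [set: V].
Proof.
move=> fV; have [c c0 H] := weight_expand.
have oV : o \in (fset_set [set: V] : seq V) by rewrite in_fset_set// in_setT.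
have ne : (fset_set [set: V] : seq V) != [::] by apply: contraTneq oV => ->.
have := H _ (fset_uniq _) ne.
have -> : [set y | y \notin fset_set [set: V] /\
    exists2 x, x \in fset_set [set: V] & adj G x y] = set0.
  by apply/seteqP; split=> y // -[+ _]; rewrite in_fset_set// in_setT.
rewrite fset_set0 big_seq_fset0; apply/negP; rewrite -ltNge mulr_gt0// (big_rem o)//= ltr_pwDl ?weight_gt0//.
by apply: sumr_ge0 => y _; rewrite ltW// weight_gt0.
Qed.

End Nonamenable.

(** * Choice of the walk length and of the Peierls constants *)

Section Constants.
Variable R : realType.

(* [N] is the size of a dyadic level set of the [2n]-step walk counts and [i]
   its level; [beta] bounds the norm of the level-set graph. *)
Lemma level_constants (d B : R) (q : nat) : 0 < B -> B < d -> exists n : nat,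
  forall (N M i : nat) (K : R),
    d ^+ (n + n) <= (n.+1 ^ (q + q) * (q * (n + n)).+1)%:R * K ->
    K <= N%:R * B ^+ (n + n) -> K <= N%:R * (2 ^ i.+1)%:R ->
    (N <= M.+1)%N -> (M <= q ^ (n + n))%N ->
    exists c a : nat, [/\ (1 < M)%N, (2 * M ^ 2 <= 2 ^ a)%N,
      B ^+ (n + n) / 2 ^+ i + B < c%:R &
      (c * a)%:R + B ^+ (n + n) / 2 ^+ i <= M%:R].
Proof.
have q1 n : ((q * (n + n)).+1 <= (2 * q + 1) * n.+1)%N.
  by rewrite mulnS mulnDl -mulnA mulnDr; lia.
have q2 n : (4 * q * n + 1 + 1 <= (4 * q + 2) * n.+1)%N.
  by rewrite mulnS mulnDl; lia.
have q3 n : (q * ((n + n) * 2) <= 4 * q * n)%N by rewrite -mulnA; lia.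
move=> B0 Bd.
(* The first summand is for [(a + 1) * beta], the second for [(B + 1) * a + 1]; each of these will
   be at most [N / 2]. *)
pose D : R := 4 * (4 * q + 2)%:R + 2 * ((B + 1) * (4 * q + 2)%:R + 1).
have s1 : 1 < (d / B) ^+ 2.
  by rewrite exprn_egt1// ltr_pdivlMr// mul1r.
(* The exponent is [q + q + 1] for the pigeonhole loss [P], plus one for the linear factor in
   [X]. *)
have [n0 Hn] := exp_ge_poly (D * (2 * q + 1)%:R) (q + q).+2 s1.
exists n0 => N M i K; have {Hn} := Hn n0 (leqnn _).
set n := n0; move=> Hn dK KB K2 NM Mq.
set P := (n.+1 ^ (q + q) * (q * (n + n)).+1)%:R : R.
have P0 : 0 < P by rewrite ltr0n muln_gt0 expn_gt0.
have Bn0 : 0 < B ^+ (n + n) by rewrite exprn_gt0.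
pose X : R := D * n.+1%:R.
have PX : P * X * B ^+ (n + n) <= d ^+ (n + n).
  rewrite -ler_pdivlMr// -expr_div_n addnn -mul2n exprM; apply: le_trans Hn.
  have -> : D * (2 * q + 1)%:R * n.+1%:R ^+ (q + q).+2 =
      (n.+1%:R ^+ (q + q) * ((2 * q + 1)%:R * n.+1%:R)) * X.
    by rewrite /X !exprS; lra.
  have X0 : 0 <= X.
    by rewrite /X /D !(mulr_ge0, addr_ge0)// ltW.
  apply: ler_wpM2r => //; rewrite /P natrM natrX; apply: ler_wpM2l.
    by rewrite exprn_ge0.
  by rewrite -natrM ler_nat q1.
have XK : X * B ^+ (n + n) <= K.
  by rewrite -(ler_pM2l P0) mulrA; exact: le_trans PX dK.
have XN : X <= N%:R by rewrite -(ler_pM2r Bn0); exact: le_trans KB.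
set beta := B ^+ (n + n) / 2 ^+ i.
have i0 : 0 < 2 ^+ i :> R by rewrite exprn_gt0.
have betaP : B ^+ (n + n) = beta * 2 ^+ i by rewrite /beta divfK// lt0r_neq0.
have b0 : 0 <= beta by rewrite divr_ge0 ?ltW.
have Xb : X * beta <= 2 * N%:R.
  rewrite -(ler_pM2r i0) -mulrA -betaP; apply: (le_trans XK); apply: (le_trans K2).
  by rewrite natrX exprS; lra.
have NMr : N%:R <= M%:R + 1 :> R by rewrite natr1 ler_nat.
(* Chosen so that [2 ^ a] is [2 * (2 ^ q) ^ (4 * n)], at least twice the square of [q ^ (n + n)]. *)
pose a := (4 * q * n + 1)%N.
have aD : (a + 1)%:R <= (4 * q + 2)%:R * n.+1%:R :> R.
  by rewrite -natrM ler_nat q2.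
have B1 : 0 <= B + 1 by lra.
have X1 : 4 * (a + 1)%:R + 2 * ((B + 1) * (a + 1)%:R + 1) <= X.
  have n1 : 1 <= n.+1%:R :> R by rewrite ler1n.
  have := ler_wpM2l B1 aD; rewrite /X /D; move: aD n1.
  by move: ((a + 1)%:R : R) ((4 * q + 2)%:R : R) (n.+1%:R : R) => x y z h1 h2 h3; lra.
(* The strict lower bound on [c] separates the two thresholds; the upper bound keeps [c * a] below
   [M]. *)
have [c [c1 c2]] : exists c : nat, beta + B < c%:R /\ c%:R <= beta + B + 1.
  have bB : 0 <= beta + B by rewrite addr_ge0// ltW.
  exists (Num.truncn (beta + B)).+1; have /andP[t1 t2] := truncn_itv bB.
  by split=> //; rewrite -natr1 lerD2r.
exists c, a; split=> //.
- have : 2 <= M%:R :> R.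
    have : 1 <= (a + 1)%:R :> R by rewrite ler1n addn1.
    by move: X1 XN NMr B1; move: ((a + 1)%:R : R) => x; nra.
  by rewrite ler_nat.
- rewrite /a addn1 (expnS 2 (4 * q * n)) leq_mul2l /=.
  apply: leq_trans (_ : (q ^ (n + n)) ^ 2 <= _)%N; first by rewrite leq_exp2r.
  rewrite -expnM; apply: leq_trans (_ : (2 ^ q) ^ ((n + n) * 2) <= _)%N.
    by case: ((n + n) * 2)%N => // k; rewrite leq_exp2r// ltnW// ltn_expl.
  by rewrite -expnM leq_exp2l// q3.
rewrite natrM; have a1 : (a + 1)%:R = a%:R + 1 :> R by rewrite addn1 -natr1.
have aa0 : 0 <= a%:R :> R by [].
have := ler_wpM2r aa0 c2; rewrite a1 in X1.
have : (a%:R + 1) * beta * 4 <= 2 * N%:R.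
  apply: le_trans Xb; rewrite mulrAC; apply: ler_wpM2r => //.
  by move: X1 B1 aa0; move: (a%:R : R) => x; nra.
move: X1 XN NMr B1 aa0 c1 b0; rewrite -/beta.
by move: (a%:R : R) (c%:R : R) (beta) => x y b *; lra.
Qed.

End Constants.

Lemma p_h_le (R : realType) (V : choiceType) (G : graph V) (Gamma : set (V -> V))
    (o : V) (x : R) : 0 <= x ->
  (forall p (mu : probability (config_space G) R), 0 <= p <= 1 -> x < p ->
     bernoulli_law p mu -> mu (has_heavy_cluster R Gamma o) <> 0%E) ->
  p_h R G Gamma o <= x.
Proof.
move=> x0 H; rewrite /p_h; set E := [set p | _].
have [->|E0] := eqVneq E set0; first by rewrite sup0.
apply: ge_sup; first by apply/set0P.
move=> p [p01 [mu mup mu0]]; rewrite leNgt; apply/negP => xp.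
exact: H p01 xp mup mu0.
Qed.

Lemma p_u_ge (R : realType) (V : choiceType) (G : graph V) (x : R) :
  connected_graph G -> infinite_set [set: V] ->
  (forall p (mu : probability (config_space G) R), 0 <= p <= 1 -> p < x ->
     bernoulli_law p mu -> mu (@unique_infinite_cluster V G) <> 1%E) ->
  x <= p_u R G.
Proof.
move=> cG Vi H; apply: lb_le_inf; last first.
  move=> p [p01 [mu mup mu1]]; rewrite leNgt; apply/negP => px.
  exact: H p01 px mup mu1.
(* Since [inf set0 = 0], the set must be shown nonempty: at [p = 1] the point mass at the all-open
   configuration is a Bernoulli law with a unique infinite cluster. *)
pose w : config G := fun=> true.
exists 1; split; first by rewrite ler01 lexx.
exists (\d_(w : config_space G)).
  move=> n e b _ /=; rewrite diracE.
  case: (pselect (forall i, b i)) => [ball|/existsNP[i /negP bi]].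
    rewrite mem_set; last by move=> i; rewrite ball.
    by rewrite big1// => i _; rewrite ball.
  rewrite memNset; first by rewrite (bigD1 i)//= (negbTE bi) subrr mul0r.
  by move=> /(_ i) /esym bi'; rewrite /w bi' in bi.
rewrite /= diracE mem_set// unique_infinite_clusterE.
have cw x' y : component (open_adj w) x' y.
  have [n xy] := cG x' y; exists n; apply: walk_sub xy => u v /exists_edge[e euv].
  by exists e.
split; last by move=> *; exact: cw.
have [x' _] : exists x' : V, True.
  apply: contrapT => /forallNP Hx; apply: Vi.
  rewrite (_ : [set: V] = set0)//; apply/seteqP; split=> y // _.
  exact: (Hx y).
exists x'; rewrite (_ : component _ _ = [set: V])//.
by apply/seteqP; split=> y // _; exact: cw.
Qed.

(** * Spectral gap and construction of the new graph *)

Section TransitiveGraph.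
Variables (R : realType) (V : choiceType) (G : graph V) (Gamma : set (V -> V)) (o : V).
Hypothesis G_connected : connected_graph G.
Hypothesis G_fin : locally_finite G.
Hypothesis Gamma_id : Gamma id.
Hypothesis Gamma_comp : forall g h, Gamma g -> Gamma h -> Gamma (g \o h).
Hypothesis Gamma_inv : forall g, Gamma g ->
  exists h, [/\ Gamma h, cancel g h & cancel h g].
Hypothesis Gamma_tr : forall x y, exists2 g, Gamma g & g x = y.
Hypothesis G_map : forall g x y, Gamma g -> adj G x y -> adj G (g x) (g y).
Hypothesis G_nonamenable : weight_nonamenable R G Gamma o.
Local Notation W := (rel_weight R Gamma).

(** Elements fixing [x] preserve the finite set of vertices reached from [x] in [n] steps. *)
Lemma finite_stab_orbit x y : finite_set (stab_orbit Gamma x y).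
Proof.
have [n xy] := G_connected x y; apply: sub_finite_set (finite_walk x n G_fin).
move=> _ [g [Gg gx] <-] /=; rewrite -{1}gx.
by apply: walk_map xy => u v; exact: G_map.
Qed.

Let V_inf : infinite_set [set: V].
Proof. exact: nonamenable_infinite finite_stab_orbit Gamma_id G_fin G_nonamenable. Qed.

Lemma countable_vertices : countable [set: V].
Proof.
rewrite (_ : [set: V] = \bigcup_n [set y | walk (adj G) o y n]).
  apply: bigcup_countable => // n _; apply: finite_set_countable.
  exact: finite_walk.
by apply/seteqP; split=> y // _; have [n oy] := G_connected o y; exists n.
Qed.

Lemma sqrt_degree_gt0 : 0 < nsum (adj G) (fun x => Num.sqrt (W o x)) o.
Proof.
have r0 x : 0 < Num.sqrt (W o x) by rewrite sqrtr_gt0 weight_gt0//; exact: finite_stab_orbit.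
have [y oy] : exists y, adj G o y.
  have [y [_ yo]] := (infinite_setP _).1 V_inf [:: o].
  have [[|n]] := G_connected o y; last by move=> /walkS[z oz _]; exists z.
  by move=> /walk0 oy; rewrite oy mem_head in yo.
rewrite /nsum (big_rem y)/=; last by rewrite mem_nb//; exact/asboolP.
by rewrite ltr_pwDl// sumr_ge0// => z _; exact: ltW.
Qed.

Lemma spectral_gap : exists B : R,
  [/\ 0 < B, B < nsum (adj G) (fun x => Num.sqrt (W o x)) o & form_bound (adj G) B].
Proof.
have ofin := finite_stab_orbit.
set r := (fun x => Num.sqrt (W o x)); set d := nsum (adj G) r o.
have d0 : 0 < d by exact: sqrt_degree_gt0.
have w0 x : 0 < W o x by exact: weight_gt0.
have r0 x : 0 < r x by rewrite sqrtr_gt0.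
have rE x : r x ^+ 2 = W o x by rewrite sqr_sqrtr// ltW.
have eig x : nsum (adj G) r x = d * r x by exact: nsum_sqrt_weight.
have [c c0 cP] := weight_expand ofin Gamma_id G_fin G_nonamenable.
have k0 : 0 < d^-1 by rewrite invr_gt0.
(* [r y] is one term of the eigenvalue sum at [x], so [r y <= d * r x]. *)
have kP x y : adj G x y -> d^-1 * W o y <= r x * r y.
  move=> xy; rewrite -rE mulrC ler_pdivrMr// expr2 mulrAC ler_pM2r//.
  rewrite mulrC -eig /nsum (big_rem y)/=; last by rewrite mem_nb//; exact/asboolP.
  by rewrite lerDl sumr_ge0// => z _; exact: ltW.
have := cheeger_form (adj_sym (g := G)) G_fin r0 rE eig k0 kP c0 cP d0.
set B := d - _ => fB.
have Bd : B < d.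
  by rewrite /B ltrBlDr ltrDl divr_gt0 ?exprn_gt0 ?mulr_gt0.
(* The maximum with [d / 2] keeps the bound positive. *)
exists (Num.max B (d / 2)); split.
- by rewrite lt_max (divr_gt0 d0)// orbT.
- by rewrite gt_max Bd ltr_pdivrMr// ltr_pMr// ltr1n.
- by apply: form_bound_le fB; rewrite le_max lexx.
Qed.

(* The edges of [G'] are those of [G] and the pairs of distinct vertices of
   equal weight joined by at least [2 ^ i] and fewer than [2 ^ i.+1] walks of
   length [2n]. *)
Lemma exists_level_graph : exists G' : graph V,
  [/\ connected_graph G' /\ locally_finite G',
      forall g x y, Gamma g -> adj G' x y -> adj G' (g x) (g y),
      quasi_isometric R G G' & p_h R G' Gamma o < p_u R G'].
Proof.
have ofin := finite_stab_orbit; have Vc := countable_vertices.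
have [B [B0 Bd fB]] := spectral_gap.
set d := nsum _ _ _ in Bd.
have d0 : 0 < d := sqrt_degree_gt0.
have Gs := adj_sym (g := G).
have [n Hn] := level_constants (size (fset_set (adj G o))) B0 Bd.
have [i Hi] := level_rel_pigeonhole Gs G_fin Gamma_id Gamma_comp Gamma_inv
  Gamma_tr ofin G_map n d0.
set N := (n + n)%N in Hn Hi.
pose L := level_rel R (adj G) Gamma N i.
pose S x y := x <> y /\ L x y.
have Lfin x : finite_set (L x) by exact: finite_level_rel.
have Ssub x : S x `<=` L x by move=> y [].
have Sfin x : finite_set (S x) by exact: sub_finite_set (Lfin x).
have Ls x y : L x y -> L y x.
  move=> [w1 xy lg]; split; last by rewrite (cnt_sym G_fin Gs).
    by rewrite (weight_sym _ Gamma_id Gamma_comp Gamma_inv ofin) w1 invr1.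
  exact: walk_sym.
have Ss x y : S x y -> S y x by move=> [xy /Ls]; split=> // /esym.
have Smap g x y : Gamma g -> S x y -> S (g x) (g y).
  move=> Gg [xy [w1 wk lg]]; split; first by move=> /(Gamma_inj Gamma_inv Gg).
  split; first by rewrite weight_map.
    by apply: walk_map wk => u v; exact: G_map.
  by rewrite (cnt_map R G_fin Gamma_inv G_map).
set M := #|` fset_set (S o)|.
have Sdeg x : size (fset_set (S x)) = M.
  have [g Gg <-] := Gamma_tr o x; rewrite /M -(card_image (Gamma_inj Gamma_inv Gg) (Sfin o)).
  congr (#|` fset_set _|); apply/seteqP; split=> y.
    move=> gy; have [h [Gh gh hg]] := Gamma_inv Gg.
    by exists (h y); rewrite ?hg//; have := Smap h _ _ Gh gy; rewrite gh.
  by move=> [z oz <-]; exact: Smap.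
have LP y : L o y -> (2 ^ i <= cnt (adj G) N o y < 2 ^ i.+1)%N.
  move=> [_ oy <-]; rewrite trunc_logP ?walk_cnt//=.
  exact: trunc_log_ltn.
have [|||| c [a [M1 Ma Bc caM]]] := Hn #|` fset_set (L o)| M i _ Hi.
- rewrite mulrC -sumr1_size mulr_sumr; apply: ler_sum => y _.
  by rewrite mulr1; exact: cnt_le.
- rewrite mulrC -sumr1_size mulr_sumr big_seq [leRHS]big_seq; apply: ler_sum => y.
  rewrite in_fset_set// in_setE mulr1 => /LP/andP[_ /ltnW].
  by rewrite ler_nat.
(* Passing from [L] to [S] removes at most the vertex [o] itself, as [G'] has no loops. *)
- rewrite -[M.+1]/(size (o :: fset_set (S o))); apply: uniq_leq_size.
    exact: fset_uniq.
  move=> y; rewrite in_fset_set// in_setE => oy; rewrite inE in_fset_set//.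
  have [//|yo] := eqVneq y o; rewrite /= in_setE; split=> // oy'.
  by rewrite oy' eqxx in yo.
- apply: leq_trans (card_level_rel R o G_fin Gamma_inv Gamma_tr G_map N i).
  apply: uniq_leq_size; first exact: fset_uniq.
  by move=> y; rewrite !in_fset_set// !in_setE; exact: Ssub.
set beta := B ^+ N / 2 ^+ i in Bc caM.
have i0 : 0 < 2 ^+ i :> R by rewrite exprn_gt0.
have beta0 : 0 < beta by rewrite divr_gt0// exprn_gt0.
(* An [S]-edge carries at least [2 ^ i] walks, so the form of [S] is at most [2 ^ -i] times that of
   the [N]-th power. *)
have fS : form_bound S beta.
  move=> s f us f0; rewrite /beta mulrAC ler_pdivlMr//.
  apply: le_trans (pow_form Gs G_fin N B0 fB us f0).
  rewrite mulr_suml; apply: ler_sum => x _; rewrite big_mkcond mulr_suml.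
  apply: ler_sum => y _; case: asboolP => [[_ [_ xy lg]]|_]; last first.
    by rewrite mul0r !mulr_ge0.
  apply: ler_wpM2l; first exact: mulr_ge0.
  by rewrite -natrX ler_nat -lg trunc_logP// walk_cnt.
have adj'_sym x y : adj G x y \/ S x y -> adj G y x \/ S y x.
  by move=> [xy|xy]; [left; exact: adj_sym|right; exact: Ss].
have adj'_irr x : ~ (adj G x x \/ S x x) by move=> [xx|[]//]; exact: adj_irrefl xx.
pose G' := Graph adj'_sym adj'_irr.
have GG' x y : adj G x y -> adj G' x y by left.
have G'map g x y : Gamma g -> adj G' x y -> adj G' (g x) (g y).
  by move=> Gg [xy|xy]; [left; exact: G_map|right; exact: Smap].
have G'c : connected_graph G'.
  by move=> x y; have [m xy] := G_connected x y; exists m; exact: walk_sub xy.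
have G'fin : locally_finite G'.
  move=> x; apply: (@sub_finite_set _ _ (adj G x `|` S x)) => //.
  by rewrite finite_setU.
exists G'; split=> //.
  apply: (@quasi_isometric_refine _ _ _ _ N.+1) => //.
  move=> x y [xy|[_ [_ xy _]]]; last by exists N.
  by exists 1%N => //; apply/walk1.
have fB' : form_bound (adj G') (beta + B).
  move=> s f us f0; rewrite mulrDl; apply: le_trans (lerD (fS s f us f0) (fB s f us f0)).
  rewrite -big_split/=; apply: ler_sum => x _.
  rewrite big_mkcond [X in _ <= X + _]big_mkcond [X in _ <= _ + X]big_mkcond -big_split/=.
  apply: ler_sum => y _; have xy0 := mulr_ge0 (f0 x) (f0 y).
  case: asboolP => [[xy|xy]|_]; last by rewrite addr_ge0//; case: ifP.
    by rewrite [X in _ + (if X then _ else _)]asboolT// lerDr; case: ifP.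
  by rewrite [X in (if X then _ else _) + _]asboolT// lerDl; case: ifP.
have c0 : 0 < c%:R :> R by apply: lt_trans Bc; rewrite addr_gt0.
have bB0 : 0 < beta + B by rewrite addr_gt0.
apply: (@le_lt_trans _ _ c%:R^-1); last apply: (@lt_le_trans _ _ (beta + B)^-1).
- apply: p_h_le; first by rewrite invr_ge0.
  move=> p mu p01 cp mup.
  have pc : 1 <= p * c%:R by rewrite -ler_pdivrMr// div1r ltW.
  apply: (@peierls R V G' Vc S M c a beta Ss _ Sfin Sdeg fS M1 caM Ma p mu p01 pc mup Gamma o).
  + by move=> x y; right.
  + exact: weight_id.
  + move=> x y [_ [w1 _ _]].
    by rewrite (weight_cocycle _ Gamma_id Gamma_comp Gamma_inv ofin o x y) w1 mulr1.
- by rewrite ltf_pV2 ?posrE.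
apply: p_u_ge => // p mu /andP[p0 _] pB mup.
apply: (@not_unique R V G' Vc G'fin p (beta + B)) => //.
- by rewrite -ltr_pdivlMr// div1r.
- move=> x y; have [g Gg gx] := Gamma_tr x y; have [h [Gh gh hg]] := Gamma_inv Gg.
  exists g, h; split=> // u v; split; last exact: G'map.
  by move=> /(G'map h _ _ Gh); rewrite !gh.
Qed.

End TransitiveGraph.

Theorem theorem1p7 (R : realType) (V : choiceType) (G : graph V)
    (Gamma : set (V -> V)) (o : V)
    (G_connected : connected_graph G)
    (G_locally_finite : locally_finite G)
    (Gamma_closed : closed_subgroup_Aut G Gamma)
    (Gamma_transitive : acts_transitively Gamma G)
    (G_nonamenable : weight_nonamenable R G Gamma o) :
  exists G' : graph V,
    [/\ connected_graph G' /\ locally_finite G',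
        acts_transitively (graph_Aut G') G',
        quasi_isometric R G G',
        acts_transitively Gamma G'
      & p_h R G' Gamma o < p_u R G'].
Proof.
have [Gamma_aut Gamma_id Gamma_comp inv _] := Gamma_closed.
have [_ Gamma_tr] := Gamma_transitive.
have Gamma_bij g : Gamma g -> bijective g by move=> /Gamma_aut[].
have Gamma_inv g : Gamma g -> exists h, [/\ Gamma h, cancel g h & cancel h g].
  by move=> Gg; have [h gh hg] := Gamma_bij g Gg; exists h; split=> //; exact: inv gh hg.
have G_map g x y : Gamma g -> adj G x y -> adj G (g x) (g y).
  by move=> /Gamma_aut[_ H] /H.
have [G' [G'c G'map G'q G'h]] := exists_level_graph G_connected G_locally_finite
  Gamma_id Gamma_comp Gamma_inv Gamma_tr G_map G_nonamenable.
have G'aut : Gamma `<=` graph_Aut G'.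
  move=> g Gg; split=> [|x y]; first exact: Gamma_bij.
  have [h [Gh gh hg]] := Gamma_inv g Gg; split; last exact: G'map.
  by move=> /(G'map h _ _ Gh); rewrite !gh.
exists G'; split=> //; split=> // x y.
by have [g Gg gx] := Gamma_tr x y; exists g => //; exact: G'aut.
Qed.
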